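(* Let $H_i,H:[0,T]\times\mathbb{R}^n\times\mathbb{R}^n\to\mathbb{R}$, $i\in\mathbb{N}$, be continuous and admissible (see context). Let $(\mathbb{R}^{n+1},f_i,l_i)$ and $(\mathbb{R}^{n+1},f,l)$ be the canonical noncompact representations of $H_i$ and $H$, respectively (see context). If $H_i$ converge to $H$ uniformly on compact subsets of $[0,T]\times\mathbb{R}^n\times\mathbb{R}^n$, then $f_i$ converge to $f$ and $l_i$ converge to $l$ uniformly on compact subsets of $[0,T]\times\mathbb{R}^n\times\mathbb{R}^{n+1}$. Furthermore, if there are measurable $c_i,c:[0,T]\to[0,\infty)$ with $|H_i(t,x,p)-H_i(t,x,q)|\le c_i(t)(1+|x|)|p-q|$ and $|H(t,x,p)-H(t,x,q)|\le c(t)(1+|x|)|p-q|$ for all $t\in[0,T]$, $x,p,q\in\mathbb{R}^n$, $i\in\mathbb{N}$, then $|f_i(t,x,a)|\le c_i(t)(1+|x|)$ and $|f(t,x,a)|\le c(t)(1+|x|)$ for all $t\in[0,T]$, $x\in\mathbb{R}^n$, $a\in\mathbb{R}^{n+1}$, $i\in\mathbb{N}$.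
   Context: $|\cdot|$ is the Euclidean norm, $B(y,r)$ is the closed ball with center $y$ and radius $r\ge0$, $B_R$ is the closed ball in $\mathbb{R}^n$ centered at $0$ with radius $R$, $d(y,K):=\inf_{z\in K}|y-z|$. A null set is a set of Lebesgue measure zero. A modulus is a function $w:[0,T]\times[0,\infty)\to[0,\infty)$ such that $w(\cdot,r)$ is measurable for every $r\ge0$ and, for every $t$, $w(t,\cdot)$ is nondecreasing, continuous, subadditive and $w(t,0)=0$. A function $H:[0,T]\times\mathbb{R}^n\times\mathbb{R}^n\to\mathbb{R}$ is called admissible if $H(\cdot,x,p)$ is measurable for all $(x,p)$, $H(t,\cdot,\cdot)$ is continuous for every $t$, $H(t,x,\cdot)$ is convex for every $(t,x)$, and for every $R>0$ there are a measurable $k_R:[0,T]\to[0,\infty)$, a modulus $w_R$ and a null set $\mathcal{N}_R$ such that $|H(t,x,p)-H(t,y,p)|\le k_R(t)|p||x-y|+w_R(t,|x-y|)$ for all $t\in[0,T]\setminus\mathcal{N}_R$, $x,y\in B_R$, $p\in\mathbb{R}^n$. (These data may be different for each $H_i$.) Steiner point: for a nonempty convex compact $K\subset\mathbb{R}^m$ let $\sigma(K,p):=\max_{x\in K}\langle p,x\rangle$, and let $m(\partial\sigma(K,p))$ be the element of minimal norm of the subdifferential of the convex function $\sigma(K,\cdot)$ at $p$. Then $s_m(K):=\frac{1}{\mathrm{vol}(B)}\int_{B}m(\partial\sigma(K,p))\,dp\in K$, where $B$ is the closed unit ball of $\mathbb{R}^m$. Canonical noncompact representation: for admissible $H$ put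 $L(t,x,v):=\sup_{p\in\mathbb{R}^n}\{\langle v,p\rangle-H(t,x,p)\}$ and $E_L(t,x):=\{(v,\eta)\in\mathbb{R}^n\times\mathbb{R}: L(t,x,v)\le\eta\}$, which is a nonempty closed convex subset of $\mathbb{R}^{n+1}$. For $a\in\mathbb{R}^{n+1}$ define $e(t,x,a):=s_{n+1}\big(E_L(t,x)\cap B(a,2d(a,E_L(t,x)))\big)\in\mathbb{R}^{n+1}$, and define $f(t,x,a)\in\mathbb{R}^n$, $l(t,x,a)\in\mathbb{R}$ by $e(t,x,a)=(f(t,x,a),l(t,x,a))$. The triple $(\mathbb{R}^{n+1},f,l)$ is the canonical noncompact representation of $H$. *)

(* Defs.v *)
From HB Require Import structures.
From mathcomp Require Import all_boot all_order all_algebra.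
From mathcomp Require Import all_classical all_reals all_analysis.

Set Implicit Arguments.
Unset Strict Implicit.
Unset Printing Implicit Defensive.

Import Order.TTheory GRing.Theory Num.Theory.
Import numFieldNormedType.Exports.

Local Open Scope classical_set_scope.
Local Open Scope ring_scope.

(* The library norm on ['rV[R]_n] is the max norm, hence [enorm]; the library
   topology and uniformity of ['rV[R]_n] are the Euclidean ones. *)
Section euclidean.
Context {R : realType} {n : nat}.
Implicit Types (x y : 'rV[R]_n) (K : set 'rV[R]_n).

Definition dotv x y : R := \sum_i x ord0 i * y ord0 i.

Definition enorm x : R := Num.sqrt (dotv x x).

Definition eball y (r : R) : set 'rV[R]_n := [set z | enorm (z - y) <= r].

Definition edist y K : R := inf [set enorm (y - z) | z in K].

End euclidean.

(* Lebesgue measure on R^m as the m-fold product of Lebesgue measure on R,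
   carried by [m.-tuple R] because the library has no sigma-algebra on
   ['rV[R]_m]. *)
Section lebesgue_tuple.
Context {R : realType}.
Local Notation RB := (measurableTypeR R).

Definition cons_pair m (z : RB * m.-tuple RB) : m.+1.-tuple RB :=
  [the m.+1.-tuple RB of z.1 :: z.2].

Lemma measurable_cons_pair m :
  measurable_fun [set: RB * m.-tuple RB] (@cons_pair m).
Proof. exact: measurable_cons. Qed.

Section step.
Variables (m : nat) (mu : {sigma_finite_measure set (m.-tuple RB) -> \bar R}).

Definition lebesgue_cons : set (m.+1.-tuple RB) -> \bar R :=
  pushforward ((@lebesgue_measure R) \x mu)%E (@cons_pair m).

Let lebesgue_cons0 : lebesgue_cons set0 = 0%E.
Proof. by rewrite /lebesgue_cons /pushforward preimage_set0 measure0. Qed.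

Let lebesgue_cons_ge0 A : (0 <= lebesgue_cons A)%E.
Proof. exact: (@measure_ge0 _ _ _ ((@lebesgue_measure R) \x mu)%E). Qed.

Let lebesgue_cons_sigma_additive : semi_sigma_additive lebesgue_cons.
Proof.
exact: (@measure_semi_sigma_additive _ _ _
  (measure_function_pushforward__canonical__measure_function_Measure
    ((@lebesgue_measure R) \x mu)%E (@measurable_cons_pair m))).
Qed.

HB.instance Definition _ := isMeasure.Build _ _ _ lebesgue_cons
  lebesgue_cons0 lebesgue_cons_ge0 lebesgue_cons_sigma_additive.

Let lebesgue_cons_sigma_finite : sigma_finite setT lebesgue_cons.
Proof.
have /sigma_finiteP[F [TF ndF Foo]] := sigma_finiteT (@lebesgue_measure R).
have /sigma_finiteP[G [TG ndG Goo]] := sigma_finiteT mu.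
pose g (t : m.+1.-tuple RB) : RB * m.-tuple RB :=
  (thead t, [tuple of behead t]).
have mg : measurable_fun setT g.
  apply/measurable_fun_pairP; split; first exact: measurable_tnth.
  exact: measurable_behead.
have gK : cancel (@cons_pair m) g.
  by case=> a t; congr pair; apply: val_inj.
exists (fun n => g @^-1` (F n `*` G n)) => [|n].
  rewrite -preimage_bigcup (_ : \bigcup_n _ = setT) ?preimage_setT//.
  rewrite -subTset => -[x y] _.
  have [i _ Fx] : (\bigcup_i F i) x by rewrite -TF.
  have [j _ Gy] : (\bigcup_i G i) y by rewrite -TG.
  exists (maxn i j) => //; split.
  - by move: x Fx; exact/subsetPset/ndF/leq_maxl.
  - by move: y Gy; exact/subsetPset/ndG/leq_maxr.
have [mF Fn] := Foo n; have [mG Gn] := Goo n.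
have mFG : measurable (F n `*` G n) by exact: measurableX.
split; first by rewrite -[_ @^-1` _]setTI; exact: mg.
rewrite /lebesgue_cons /pushforward -comp_preimage.
rewrite (_ : g \o _ = id); last by rewrite funeqE => z /=; rewrite gK.
by rewrite preimage_id product_measure1E// lte_mul_pinfty// ge0_fin_numE.
Qed.

HB.instance Definition _ := Measure_isSigmaFinite.Build _ _ _ lebesgue_cons
  lebesgue_cons_sigma_finite.

End step.

Fixpoint lebesgue_tuple m : {sigma_finite_measure set (m.-tuple RB) -> \bar R} :=
  match m with
  | 0 => \d_ ([tuple] : 0.-tuple RB)
  | m'.+1 => lebesgue_cons (lebesgue_tuple m')
  end.

End lebesgue_tuple.

Section steiner.
Context {R : realType} {m : nat}.
Implicit Types (K : set 'rV[R]_m) (p : 'rV[R]_m).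

(* For nonempty compact [K] the supremum is a maximum. *)
Definition support_fun K p : R := sup [set dotv p x | x in K].

Definition subdifferential (g : 'rV[R]_m -> R) p : set 'rV[R]_m :=
  [set v | forall q, g p + dotv v (q - p) <= g q].

Definition is_min_norm (S : set 'rV[R]_m) (v : 'rV[R]_m) :=
  S v /\ forall u, S u -> enorm v <= enorm u.

(* Junk value 0 if [S] has no element of minimal norm; a nonempty closed convex
   [S] has exactly one. *)
Definition min_norm (S : set 'rV[R]_m) : 'rV[R]_m := xget 0 (is_min_norm S).

Definition row_of_tuple (t : m.-tuple (measurableTypeR R)) : 'rV[R]_m :=
  \row_i tnth t i.

Definition unit_ball : set (m.-tuple (measurableTypeR R)) :=
  row_of_tuple @^-1` eball 0 1.

Definition steiner K : 'rV[R]_m :=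
  \row_i ((fine (lebesgue_tuple m unit_ball))^-1 *
    \int[lebesgue_tuple m]_(p in unit_ball)
      min_norm (subdifferential (support_fun K) (row_of_tuple p)) ord0 i).

End steiner.

Section hamiltonian.
Context {R : realType} {n : nat}.
Implicit Types (T : R) (H : R -> 'rV[R]_n -> 'rV[R]_n -> R).

(* [lebesgue_measurable_fun] is measurability with respect to the completed
   sigma-algebra; the library's structure on [R] itself is the Borel one. *)
Definition lebesgue_measurable_fun (D : set R) (f : R -> R) :=
  measurable_fun
    (D : set (caratheodory_type ((wlength (@idfun R))^*)%mu))
    (f : caratheodory_type ((wlength (@idfun R))^*)%mu -> R).

(* Functions on [0, T] x ... or on [0, +oo[ are total functions of which only
   the values on the domain matter. *)
Definition is_modulus T (w : R -> R -> R) :=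
  [/\ forall t r, t \in `[0, T] -> 0 <= r -> 0 <= w t r,
      forall r, 0 <= r -> lebesgue_measurable_fun `[0, T] (w ^~ r) &
      forall t, t \in `[0, T] ->
        [/\ {in >= 0 &, {homo w t : r s / r <= s}},
            {within `[0, +oo[, continuous (w t)},
            {in >= 0 &, forall r s, w t (r + s) <= w t r + w t s} &
            w t 0 = 0]].

Definition admissible T H :=
  [/\ forall x p, lebesgue_measurable_fun `[0, T] (fun t => H t x p),
      forall t, t \in `[0, T] ->
        continuous (fun z : 'rV[R]_n * 'rV[R]_n => H t z.1 z.2),
      forall t x, t \in `[0, T] -> convex_function setT (H t x) &
      forall r, 0 < r -> exists k w N,
        [/\ lebesgue_measurable_fun `[0, T] k,
            forall t, t \in `[0, T] -> 0 <= k t,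
            is_modulus T w,
            lebesgue_measure.-negligible N &
            forall t x y p, t \in `[0, T] -> ~ N t ->
              eball 0 r x -> eball 0 r y ->
              `|H t x p - H t y p| <=
                k t * enorm p * enorm (x - y) + w t (enorm (x - y))]].

Definition lagrangian H t x v : \bar R :=
  ereal_sup [set (dotv v p - H t x p)%:E | p in [set: 'rV[R]_n]].

(* The pair (v, eta) of R^n x R is the row vector [row_mx v eta%:M]. *)
Definition epi_lagrangian H t x : set 'rV[R]_(n + 1) :=
  [set e | (lagrangian H t x (lsubmx e) <= (rsubmx e ord0 ord0)%:E)%E].

Definition rep_e H t x (a : 'rV[R]_(n + 1)) : 'rV[R]_(n + 1) :=
  let E := epi_lagrangian H t x in steiner (E `&` eball a (2 * edist a E)).

Definition rep_f H t x a : 'rV[R]_n := lsubmx (rep_e H t x a).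

Definition rep_l H t x a : R := rsubmx (rep_e H t x a) ord0 ord0.

End hamiltonian.

Section domains.
Context {R : realType} {n m : nat}.

Definition tdomain (T : R) : set (R * 'rV[R]_n * 'rV[R]_m) :=
  [set z | z.1.1 \in `[0, T]].

Definition uncurry3 {V : Type} (g : R -> 'rV[R]_n -> 'rV[R]_m -> V)
    (z : R * 'rV[R]_n * 'rV[R]_m) : V := g z.1.1 z.1.2 z.2.

Definition compact_cvg {V : uniformType} (T : R)
    (g_ : nat -> R -> 'rV[R]_n -> 'rV[R]_m -> V)
    (g : R -> 'rV[R]_n -> 'rV[R]_m -> V) :=
  forall K, compact K -> K `<=` tdomain T ->
    {uniform K, (fun i => uncurry3 (g_ i)) @ \oo --> uncurry3 g}.

End domains.

(* Main.v *)
Require Import Defs.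
From mathcomp Require Import all_boot all_order all_algebra.
From mathcomp Require Import all_classical all_reals all_analysis.
From mathcomp Require Import measurable_realfun.
From mathcomp Require Import ring lra.

Import Order.TTheory GRing.Theory Num.Theory.
Import numFieldNormedType.Exports.

Local Open Scope classical_set_scope.
Local Open Scope ring_scope.

(** The value [e(t, x, a)] is the Steiner point of the set [K] obtained by cutting
the epigraph [E] of the Lagrangian with the ball [B(a, 2 d(a, E))], and the
convergence is proved by following the Hamiltonian through this construction.

_From Hamiltonians to epigraphs._ [E] is the intersection of the half-spaces
[<(p, -1), e> <= H(t, x, p)]. If convex functions converge locally uniformly,
these sets converge in the sense of Painleve and Kuratowski
([kuratowski_epi_conjugate]). The substantial half, that every point of the
limit is approached, is obtained from minimizers of quadratic perturbations of
the functions, which live in a fixed ball ([subdifferential_prox]).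

_From epigraphs to truncations._ The distances to a converging centre converge,
and so do the support functions of the truncations ([edist_cvg],
[support_truncation_cvg]). The factor 2 matters here: a point of the truncation
moved towards the nearest point of [E] gets into the interior of the ball, and
then it can be approximated by points of the converging truncations.

_From support functions to Steiner points._ The Steiner point is the average over
the unit ball of the subgradient of minimal norm of the support function. If
support functions converge pointwise, their subgradients converge at every point
where the limit has partial derivatives ([subdifferential_coord_cvg]). The other
points are covered by countably many closed sets, each of which meets every line
parallel to some axis at most once, and which are null by Fubini's theorem
([kink_null]). Dominated convergence gives [steiner_cvg]. The measurability of the
subgradient of minimal norm at [p] comes from writing it as the limit of the
projections of [k p] on [K] ([nearest_cvg_min_norm]).

Altogether [e] converges continuously, that is along all converging sequences of
arguments and indices; on compact sets this is uniform convergence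
([rep_e_compact_cvg]). For the bound on [f], a function with Lipschitz constant
[C] has a conjugate whose effective domain lies in the ball of radius [C], and the
averages over points of this ball stay in the ball. *)

Set Implicit Arguments.
Unset Strict Implicit.

(** * Euclidean geometry of row vectors *)

Section euclidean_geometry.
Context {R : realType} {m : nat}.
Implicit Types (x y z : 'rV[R]_m) (a : R).

Lemma dotvC x y : dotv x y = dotv y x.
Proof. by apply: eq_bigr => i _; rewrite mulrC. Qed.

Lemma dotvDl x y z : dotv (x + y) z = dotv x z + dotv y z.
Proof. by rewrite -big_split; apply: eq_bigr => i _; rewrite mxE mulrDl. Qed.

Lemma dotvZl a x y : dotv (a *: x) y = a * dotv x y.
Proof. by rewrite mulr_sumr; apply: eq_bigr => i _; rewrite mxE mulrA. Qed.

Lemma dotvNl x y : dotv (- x) y = - dotv x y.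
Proof. by rewrite -scaleN1r dotvZl mulN1r. Qed.

Lemma dotvDr x y z : dotv x (y + z) = dotv x y + dotv x z.
Proof. by rewrite dotvC dotvDl !(dotvC x). Qed.

Lemma dotvZr a x y : dotv x (a *: y) = a * dotv x y.
Proof. by rewrite dotvC dotvZl dotvC. Qed.

Lemma dotvNr x y : dotv x (- y) = - dotv x y.
Proof. by rewrite dotvC dotvNl dotvC. Qed.

Lemma dotv0l x : dotv 0 x = 0.
Proof. by rewrite -(scale0r 0) dotvZl mul0r. Qed.

Lemma dotv0r x : dotv x 0 = 0. Proof. by rewrite dotvC dotv0l. Qed.

Definition dotvE := (dotvDl, dotvDr, dotvNl, dotvNr, dotvZl, dotvZr,
  dotv0l, dotv0r).

Lemma dotv_delta i x : dotv (delta_mx ord0 i) x = x ord0 i.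
Proof.
rewrite /dotv (bigD1 i)//= mxE !eqxx mul1r big1 ?addr0// => j /negbTE ji.
by rewrite mxE eqxx ji mul0r.
Qed.

Lemma dotv_ge0 x : 0 <= dotv x x.
Proof. by apply: sumr_ge0 => i _; rewrite -expr2 sqr_ge0. Qed.

Lemma enorm_ge0 x : 0 <= enorm x. Proof. exact: sqrtr_ge0. Qed.

Lemma enorm_sqr x : enorm x ^+ 2 = dotv x x.
Proof. by rewrite sqr_sqrtr// dotv_ge0. Qed.

Lemma enormE2 x y : (enorm x <= enorm y) = (dotv x x <= dotv y y).
Proof. by rewrite ler_sqrt// dotv_ge0. Qed.

Lemma enorm0 : enorm (0 : 'rV[R]_m) = 0.
Proof. by rewrite /enorm dotv0l sqrtr0. Qed.

Lemma dotv_eq0 x : dotv x x <= 0 -> x = 0.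
Proof.
move=> xx0; have /eqP := le_anti (introT andP (conj xx0 (dotv_ge0 x))).
rewrite psumr_eq0; last by move=> i _; rewrite -expr2 sqr_ge0.
move=> /allP xi0; apply/rowP => i; rewrite mxE.
by have /(_ (mem_index_enum i)) := xi0 i; rewrite mulf_eq0 orbb => /eqP.
Qed.

(** Cauchy-Schwarz, from the nonnegativity of the square of
[<y, y> x - <x, y> y]. *)
Lemma dotv_le x y : dotv x y <= enorm x * enorm y.
Proof.
suff : dotv x y ^+ 2 <= (enorm x * enorm y) ^+ 2.
  rewrite -ler_sqrt ?sqr_ge0// !sqrtr_sqr.
  rewrite (ger0_norm (mulr_ge0 (enorm_ge0 _) (enorm_ge0 _))).
  exact/le_trans/ler_norm.
rewrite exprMn !enorm_sqr; have [yy0|yy0] := leP (dotv y y) 0.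
  by rewrite (dotv_eq0 yy0) !dotv0r expr0n mulr0.
have := dotv_ge0 (dotv y y *: x - dotv x y *: y).
rewrite !dotvE (dotvC y x) => ge0; rewrite -(ler_pM2l yy0); lra.
Qed.

Lemma enormZ a x : enorm (a *: x) = `|a| * enorm x.
Proof.
by rewrite /enorm !dotvE mulrA -expr2 sqrtrM ?sqr_ge0// sqrtr_sqr.
Qed.

Lemma enormN x : enorm (- x) = enorm x.
Proof. by rewrite -scaleN1r enormZ normrN1 mul1r. Qed.

Lemma enormBC x y : enorm (x - y) = enorm (y - x).
Proof. by rewrite -enormN opprB. Qed.

Lemma enormD x y : enorm (x + y) <= enorm x + enorm y.
Proof.
rewrite -ler_sqr ?nnegrE ?addr_ge0 ?enorm_ge0// enorm_sqr !dotvE (dotvC y).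
have := dotv_le x y; have := enorm_sqr x; have := enorm_sqr y; nra.
Qed.

Lemma enorm_triangle z x y : enorm (x - y) <= enorm (x - z) + enorm (z - y).
Proof. by rewrite -(subrKA z) enormD. Qed.

Lemma coord_le_enorm x i : `|x ord0 i| <= enorm x.
Proof.
rewrite -sqrtr_sqr ler_sqrt ?dotv_ge0// /dotv (bigD1 i)//= -expr2 lerDl.
by apply: sumr_ge0 => j _; rewrite -expr2 sqr_ge0.
Qed.

(** The norm of ['rV[R]_m] is the maximum norm; this comparison turns Euclidean
estimates into convergence. *)
Lemma norm_le_enorm x : `|x| <= enorm x.
Proof.
rewrite [leLHS]/Num.Def.normr/= mx_normrE; apply: bigmax_le => [|[i j] _ /=].
  exact: enorm_ge0.
by rewrite ord1 coord_le_enorm.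
Qed.

Lemma dotv_cvg T (F : set_system T) {FF : Filter F} (f g : T -> 'rV[R]_m) x y :
  f @ F --> x -> g @ F --> y -> (fun t => dotv (f t) (g t)) @ F --> dotv x y.
Proof.
move=> fx gy; apply: cvg_big => //; first exact: add_continuous.
move=> i _; apply: cvgM.
  exact: (cvg_comp _ _ fx (@coord_continuous _ _ _ ord0 i x)).
exact: (cvg_comp _ _ gy (@coord_continuous _ _ _ ord0 i y)).
Qed.

Lemma enorm_cvg T (F : set_system T) {FF : Filter F} (f : T -> 'rV[R]_m) x :
  f @ F --> x -> (fun t => enorm (f t)) @ F --> enorm x.
Proof.
move=> fx; have xx : dotv (f t) (f t) @[t --> F] --> dotv x x.
  exact: dotv_cvg.
exact: (cvg_comp _ _ xx (@sqrt_continuous _ _)).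
Qed.

Lemma enormB_cvg T (F : set_system T) {FF : Filter F} (f g : T -> 'rV[R]_m)
    x y :
  f @ F --> x -> g @ F --> y ->
  (fun t => enorm (f t - g t)) @ F --> enorm (x - y).
Proof. by move=> fx gy; apply: enorm_cvg; exact: cvgB. Qed.

Lemma cvg_enorm T (F : set_system T) {FF : Filter F} (f : T -> 'rV[R]_m) x :
  (forall e, 0 < e -> \forall t \near F, enorm (f t - x) <= e) -> f @ F --> x.
Proof.
move=> fx; apply/cvgrPdist_le => e e0.
apply: filterS (fx e e0) => t; apply: le_trans.
by rewrite distrC norm_le_enorm.
Qed.

Lemma near_enorm T (F : set_system T) {FF : Filter F} (f : T -> 'rV[R]_m) x :
  f @ F --> x -> forall e, 0 < e -> \forall t \near F, enorm (f t - x) < e.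
Proof.
move=> fx e e0; have : enorm (f t - x) @[t --> F] --> enorm (x - x).
  by apply: enormB_cvg => //; exact: cvg_cst.
by rewrite subrr enorm0 => /cvgr_lt h; exact: h.
Qed.

(** First-order conditions at a minimum come in this form, once the comparison
with a point at distance [s] along a segment is divided by [s]. *)
Lemma le0_small (c d : R) : (forall s, 0 < s <= 1 -> c <= s * d) -> c <= 0.
Proof.
move=> cd; rewrite leNgt; apply/negP => c0.
have := cd 1; rewrite ltr01 lexx mul1r => /(_ isT) cled.
have d0 : 0 < d by lra.
have := cd (c / (2 * d)).
have -> : c / (2 * d) * d = c / 2 by field; lra.
rewrite divr_gt0 ?mulr_gt0//= ler_pdivrMr ?mulr_gt0// => /(_ _); lra.
Qed.

Lemma closed_lef (T : topologicalType) (f g : T -> R) :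
  continuous f -> continuous g -> closed [set t | f t <= g t].
Proof.
move=> cf cg.
rewrite (_ : [set _ | _] = (fun t => g t - f t) @^-1` [set r | 0 <= r]).
  apply: preimage_closed; last exact: closed_ge.
  by move=> t _; apply: (@cvgB _ _ _ (nbhs t)); [exact: cg|exact: cf].
by apply/seteqP; split => t /=; rewrite subr_ge0.
Qed.

Lemma enormB_continuous y : continuous (fun z => enorm (z - y)).
Proof.
move=> z; apply: (@enormB_cvg _ (nbhs z)); [exact: cvg_id|exact: cvg_cst].
Qed.

Lemma dotv_continuous y : continuous (dotv y).
Proof.
move=> z; apply: (@dotv_cvg _ (nbhs z)); [exact: cvg_cst|exact: cvg_id].
Qed.

Lemma eball_closed y a : closed (eball y a).
Proof. by apply: closed_lef; [exact: enormB_continuous|exact: cst_continuous]. Qed.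

Lemma eball_compact y a : compact (eball y a).
Proof.
apply: bounded_closed_compact; last exact: eball_closed.
exists (a + enorm y); split; first exact: num_real.
move=> M aM z /= zya; rewrite (le_trans (norm_le_enorm z))//.
rewrite -(subrK y z) (le_trans (enormD _ _))// (le_trans _ (ltW aM))//.
by rewrite lerD2r.
Qed.

Lemma closed_bounded_compact (K : set 'rV[R]_m) y a :
  closed K -> K `<=` eball y a -> compact K.
Proof. by move=> cK /(subclosed_compact cK (@eball_compact y a)). Qed.

Lemma convex_setE (K : set 'rV[R]_m) x y a :
  convex_set K -> K x -> K y -> 0 <= a <= 1 -> K (a *: x + (1 - a) *: y).
Proof.
move=> cK Kx Ky /andP[a0 a1].
by have := cK x y (Itv01 a0 a1) (mem_set Kx) (mem_set Ky); rewrite inE.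
Qed.

Lemma convex_setPI (K : set 'rV[R]_m) :
  (forall x y a, K x -> K y -> 0 <= a <= 1 -> K (a *: x + (1 - a) *: y)) ->
  convex_set K.
Proof.
move=> cK x y l; rewrite !inE => Kx Ky; apply: cK => //.
by rewrite ge0 le1.
Qed.

End euclidean_geometry.

(** * Nearest points of closed convex sets *)

Section nearest_point.
Context {R : realType} {m : nat}.
Implicit Types (x y z a b v w : 'rV[R]_m) (K : set 'rV[R]_m).

Definition is_nearest K a y :=
  K y /\ forall z, K z -> enorm (a - y) <= enorm (a - z).

Definition nearest K a : 'rV[R]_m := xget 0 (is_nearest K a).

(** Only the part of [K] at distance at most [enorm (a - z0)] from [a] competes,
where [z0] is any point of [K], and that part is compact. *)
Lemma nearestP K a : closed K -> K !=set0 -> is_nearest K a (nearest K a).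
Proof.
move=> cK [z0 Kz0].
pose A := K `&` eball a (enorm (a - z0)).
have cA : compact A.
  apply: (@closed_bounded_compact _ _ _ a (enorm (a - z0))) => [|z []//].
  by apply: closedI => //; exact: eball_closed.
have A0 : A !=set0 by exists z0; split => //; rewrite /eball/= enormBC.
have ca : {within A, continuous (fun z => enorm (a - z))}.
  apply: continuous_subspaceT => z.
  by apply: (@enormB_cvg _ _ _ (nbhs z)); [exact: cvg_cst|exact: cvg_id].
have [y /set_mem[Ky ya] ymin] := EVT_min_rV A0 cA ca.
suff ex : exists y, is_nearest K a y by exact: (xgetPex 0 ex).
exists y; split => // z Kz.
have [zA|] := pselect (A z); first by apply: ymin; exact: mem_set.
move=> /not_andP[//|]; rewrite /eball/= => /negP; rewrite -ltNge => za.
by rewrite enormBC (le_trans (ya : enorm (y - a) <= _))// ltW// (enormBC a z).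
Qed.

(** Moving from [y] towards [z] stays in [K] and hence does not decrease the
distance to [a]. *)
Lemma is_nearest_obtuse K a y z : convex_set K -> is_nearest K a y -> K z ->
  dotv (a - y) (z - y) <= 0.
Proof.
move=> cvK [Ky ymin] Kz.
suff : 2 * dotv (a - y) (z - y) <= 0 by lra.
apply: (@le0_small _ _ (dotv (z - y) (z - y))) => s /andP[s0 s1].
have := ymin _ (convex_setE cvK Kz Ky (introT andP (conj (ltW s0) s1))).
have -> : a - (s *: z + (1 - s) *: y) = (a - y) - s *: (z - y).
  by apply/rowP => i; rewrite !mxE; ring.
rewrite enormE2 [leRHS]dotvDl ![dotv _ (a - y - _)]dotvDr.
rewrite -(ler_pM2l s0) !(dotvNl, dotvNr, dotvZl, dotvZr).
rewrite (dotvC (z - y) (a - y)) ler_pM2l// => h.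
by rewrite -(ler_pM2l s0); lra.
Qed.

Lemma is_nearest_unique K a y z : convex_set K ->
  is_nearest K a y -> is_nearest K a z -> y = z.
Proof.
move=> cvK ya za; have [Ky _] := ya; have [Kz _] := za.
have := is_nearest_obtuse cvK ya Kz; have := is_nearest_obtuse cvK za Ky.
move=> h1 h2; apply/eqP; rewrite -subr_eq0; apply/eqP; apply: dotv_eq0.
by move: h1 h2; rewrite !dotvE; rewrite (dotvC z y); lra.
Qed.

(** The obtuse angles at both nearest points add up to
[|u - v|^2 <= <a - b, u - v>]. *)
Lemma nearest_nonexpansive K a b : closed K -> convex_set K -> K !=set0 ->
  enorm (nearest K a - nearest K b) <= enorm (a - b).
Proof.
move=> cK cvK K0; have aP := nearestP a cK K0; have bP := nearestP b cK K0.
have [Ka _] := aP; have [Kb _] := bP.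
have := is_nearest_obtuse cvK aP Kb; have := is_nearest_obtuse cvK bP Ka.
set u := nearest K a; set v := nearest K b => h1 h2.
have [->|uv] := eqVneq u v; first by rewrite subrr enorm0 enorm_ge0.
have uv0 : 0 < enorm (u - v).
  rewrite lt_neqAle enorm_ge0 andbT eq_sym; apply: contra uv => /eqP uv0.
  rewrite -subr_eq0; apply/eqP/dotv_eq0.
  by rewrite -enorm_sqr uv0 expr0n.
rewrite -(ler_pM2r uv0) (le_trans _ (dotv_le _ _))// -expr2 enorm_sqr.
move: h1 h2; rewrite !dotvE (dotvC v u); lra.
Qed.

Lemma nearest_continuous K : closed K -> convex_set K -> K !=set0 ->
  continuous (nearest K).
Proof.
move=> cK cvK K0 a; apply: (@cvg_enorm _ _ _ (nbhs a)) => e e0.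
apply: filterS (near_enorm (@cvg_id _ (nbhs a)) e0) => b /ltW; apply: le_trans.
exact: nearest_nonexpansive.
Qed.

Lemma edist_nearest K a : closed K -> K !=set0 ->
  Defs.edist a K = enorm (a - nearest K a).
Proof.
move=> cK K0; have [Ky ymin] := nearestP a cK K0.
apply/eqP; rewrite eq_le; apply/andP; split.
  apply: ge_inf; last by exists (nearest K a).
  by exists 0 => _ [z _ <-]; exact: enorm_ge0.
apply: lb_le_inf; first by exists (enorm (a - nearest K a)), (nearest K a).
by move=> _ [z Kz <-]; exact: ymin.
Qed.

End nearest_point.

(** * Support functions and their minimal subgradients *)

Section support_function.
Context {R : realType} {m : nat}.
Implicit Types (x y p q v w : 'rV[R]_m) (K : set 'rV[R]_m).

Lemma compact_enorm_le K : compact K ->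
  exists2 M, 0 <= M & forall x, K x -> enorm x <= M.
Proof.
move=> cK; have [->|/set0P K0] := eqVneq K set0; first by exists 0.
have cn : {within K, continuous (@enorm R m)}.
  apply: continuous_subspaceT => z.
  by apply: (@enorm_cvg _ _ _ (nbhs z)); exact: cvg_id.
have [c _ cmax] := EVT_max_rV K0 cK cn.
by exists (enorm c) => [|x Kx]; [exact: enorm_ge0|exact/cmax/mem_set].
Qed.

Lemma support_ge K p x : compact K -> K x -> dotv p x <= support_fun K p.
Proof.
move=> /compact_enorm_le[M M0 KM] Kx; apply: ub_le_sup; last by exists x.
exists (enorm p * M) => _ [y Ky <-]; rewrite (le_trans (dotv_le _ _))//.
by rewrite ler_wpM2l ?enorm_ge0// KM.
Qed.

Lemma support_le K p c : K !=set0 -> (forall x, K x -> dotv p x <= c) ->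
  support_fun K p <= c.
Proof.
move=> [x Kx] Kc; apply: ge_sup; first by exists (dotv p x), x.
by move=> _ [y Ky <-]; exact: Kc.
Qed.

Lemma support_attained K p : compact K -> K !=set0 ->
  exists2 x, K x & dotv p x = support_fun K p.
Proof.
move=> cK K0.
have cp : {within K, continuous (dotv p)}.
  by apply: continuous_subspaceT; exact: dotv_continuous.
have [c /set_mem Kc cmax] := EVT_max_rV K0 cK cp; exists c => //.
apply/eqP; rewrite eq_le support_ge//=.
by apply: support_le => // x Kx; exact/cmax/mem_set.
Qed.

Lemma support_continuous K : compact K -> K !=set0 ->
  continuous (support_fun K).
Proof.
move=> cK K0; have [M M0 KM] := compact_enorm_le cK.
have lip p q : support_fun K p - support_fun K q <= M * enorm (p - q).
  have [x Kx <-] := support_attained p cK K0.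
  have := support_ge q cK Kx; have := dotv_le (p - q) x.
  have : enorm (p - q) * enorm x <= M * enorm (p - q).
    by rewrite mulrC ler_wpM2r ?enorm_ge0// KM.
  by rewrite !dotvE; lra.
move=> p; apply/(@cvgrPdist_le _ _ _ (nbhs p)) => e e0.
have M1 : 0 < M + 1 by lra.
apply: filterS (near_enorm (@cvg_id _ (nbhs p)) (divr_gt0 e0 M1)) => q.
rewrite ltr_pdivlMr// => /ltW pq.
have := lip p q; have := lip q p; rewrite (enormBC p q).
have := enorm_ge0 (q - p) => h1 h2 h3.
by rewrite ler_norml; apply/andP; split; lra.
Qed.

(** A subgradient [v] of the support function at [p] belongs to [K]: otherwise
the direction from the point of [K] nearest to [v] towards [v] would separate
[v] from [K], against the homogeneity of the support function. *)
Lemma subdifferential_support K p : compact K -> convex_set K -> K !=set0 ->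
  subdifferential (support_fun K) p =
  K `&` [set x | dotv p x = support_fun K p].
Proof.
move=> cK cvK K0; have clK : closed K by apply: compact_closed.
have sup0 : support_fun K 0 <= 0.
  by apply: support_le => // x _; rewrite dotv0l.
apply/seteqP; split => [v sv|v [Kv pv] q]; last first.
  by have := support_ge q cK Kv; rewrite -pv !dotvE (dotvC v p) (dotvC v q); lra.
have pv : support_fun K p <= dotv p v.
  by have := sv 0; rewrite sub0r dotvNr (dotvC v); lra.
have vp : dotv p v <= support_fun K p.
  have := sv (p + p); have : support_fun K (p + p) <= 2 * support_fun K p.
    apply: support_le => // x Kx; rewrite dotvDl.
    by have := support_ge p cK Kx; lra.
  by rewrite addrK (dotvC v); lra.
split => /=; last by apply/eqP; rewrite eq_le vp pv.
have [Kw wv] := nearestP v clK K0; set w := nearest K v in Kw wv.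
have obt := is_nearest_obtuse cvK (conj Kw wv).
suff -> : v = w by [].
apply/eqP; rewrite -subr_eq0; apply/eqP/dotv_eq0.
have := sv (v - w + p); rewrite addrK.
have : support_fun K (v - w + p) <= dotv (v - w) w + support_fun K p.
  apply: support_le => // x Kx; rewrite dotvDl lerD ?support_ge//.
  by have := obt _ Kx; rewrite dotvDr dotvNr; lra.
by rewrite !dotvE (dotvC v w); lra.
Qed.

Lemma subdifferential_support_closed K p : compact K -> convex_set K ->
  K !=set0 -> closed (subdifferential (support_fun K) p).
Proof.
move=> cK cvK K0; rewrite subdifferential_support//.
apply: closedI; first exact: compact_closed.
apply: (@preimage_closed _ _ (dotv p) [set r | r = support_fun K p]).
  by move=> z _; exact: dotv_continuous.
exact: closed_eq.
Qed.

Lemma subdifferential_support_convex K p : compact K -> convex_set K ->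
  K !=set0 -> convex_set (subdifferential (support_fun K) p).
Proof.
move=> cK cvK K0; rewrite subdifferential_support//.
apply: convex_setPI => x y a [Kx px] [Ky py] a01; split.
  exact: convex_setE.
by rewrite /= !dotvE px py; ring.
Qed.

Lemma subdifferential_support_neq0 K p : compact K -> convex_set K ->
  K !=set0 -> subdifferential (support_fun K) p !=set0.
Proof.
move=> cK cvK K0; rewrite subdifferential_support//.
by have [x Kx px] := support_attained p cK K0; exists x.
Qed.

Lemma is_min_normE (S : set 'rV[R]_m) v : is_min_norm S v = is_nearest S 0 v.
Proof.
rewrite /is_min_norm /is_nearest propeqE; split=> -[Sv vmin]; split => // u /vmin;
  by rewrite !sub0r !enormN.
Qed.

Lemma min_norm_supportP K p : compact K -> convex_set K -> K !=set0 ->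
  is_min_norm (subdifferential (support_fun K) p)
    (min_norm (subdifferential (support_fun K) p)).
Proof.
move=> cK cvK K0; set S := subdifferential _ _.
have ex : exists v, is_min_norm S v.
  exists (nearest S 0); rewrite is_min_normE; apply: nearestP.
    exact: subdifferential_support_closed.
  exact: subdifferential_support_neq0.
exact: (xgetPex 0 ex).
Qed.

Lemma min_norm_support_mem K p : compact K -> convex_set K -> K !=set0 ->
  K (min_norm (subdifferential (support_fun K) p)).
Proof.
move=> cK cvK K0; have [+ _] := min_norm_supportP p cK cvK K0.
by rewrite {1}subdifferential_support// => -[].
Qed.

(** The projections [u k] of the dilations [k p] solve the Tikhonov
regularisation [max <p, x> - |x|^2 / (2 k)] of the maximisation of [<p, .>]
over [K], whose solution set is the subdifferential; as the regularisation
vanishes they converge to the solution of minimal norm. This exhibits the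
minimal selection, which need not be continuous in [p], as a limit of
continuous maps. *)
Lemma nearest_cvg_min_norm K p : compact K -> convex_set K -> K !=set0 ->
  (fun k : nat => nearest K (k%:R *: p)) @ \oo -->
    min_norm (subdifferential (support_fun K) p).
Proof.
move=> cK cvK K0; have clK : closed K by apply: compact_closed.
set v := min_norm _; have vP := min_norm_supportP p cK cvK K0.
have Sv : subdifferential (support_fun K) p v by case: vP.
have [Kv pv] : K v /\ dotv p v = support_fun K p.
  by move: Sv; rewrite subdifferential_support// => -[].
pose u k := nearest K (k%:R *: p).
have uP k : is_nearest K (k%:R *: p) (u k) by exact: nearestP.
have Ku k : K (u k) by case: (uP k).
have reg k : dotv (u k) (u k) + 2 * k%:R * (support_fun K p - dotv p (u k))
             <= dotv v v.
  have [_ /(_ _ Kv)] := uP k; rewrite enormE2 -pv !dotvE.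
  by rewrite (dotvC v p) (dotvC (u k) p); lra.
have pu k : dotv p (u k) <= support_fun K p by exact: support_ge.
have uv k : enorm (u k) <= enorm v.
  rewrite enormE2 (le_trans _ (reg k))// lerDl mulr_ge0//.
  by rewrite subr_ge0.
apply: cvg_enorm => e e0.
pose C := K `&` [set x | e <= enorm (x - v)].
have cC : compact C.
  apply: subclosed_compact cK _; last by move=> x [].
  apply: closedI; first exact: clK.
  by apply: closed_lef; [exact: cst_continuous|exact: enormB_continuous].
have : \forall k \near \oo, C `<=` (fun x => x <> u k).
  apply: (iffLR (compact_near_coveringP C) cC _ _ (fun k x => x <> u k)) => x.
  move=> [Kx xv]; have [px|px] := eqVneq (dotv p x) (support_fun K p).
    (* Here [x] is another subgradient, so it is strictly longer than [v], and
    hence than every [u k]. *)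
    have vx : enorm v < enorm x.
      rewrite ltNge; apply/negP => xlev; move: xv => /=; suff -> : x = v.
        by rewrite subrr enorm0 leNgt e0.
      have Sx : subdifferential (support_fun K) p x.
        by rewrite subdifferential_support.
      move: vP; rewrite is_min_normE => vN.
      apply: is_nearest_unique vN; first exact: subdifferential_support_convex.
      rewrite -is_min_normE; split => // y Sy; rewrite (le_trans xlev)//.
      by have [_ /(_ _ Sy)] := min_norm_supportP p cK cvK K0.
    have nx : enorm y @[y --> x] --> enorm x.
      by apply: (@enorm_cvg _ _ _ (nbhs x)); exact: cvg_id.
    exists ([set y | enorm v < enorm y], setT); last first.
      move=> [y k] [/= + _ yuk]; rewrite yuk => /lt_le_trans/(_ (uv k)).
      by rewrite ltxx.
    by split; [exact: (cvgr_gt _ nx)|exact: filterT].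
  have {}px : dotv p x < support_fun K p by rewrite lt_neqAle px support_ge.
  (* Here [x] misses the maximum of [<p, .>] by [2 d], whereas [reg] forces the
  defect of [u k] to be at most [|v|^2 / (2 k)]. *)
  pose d := (support_fun K p - dotv p x) / 2.
  have d0 : 0 < d by rewrite divr_gt0// subr_gt0.
  have nx : dotv p y @[y --> x] --> dotv p x.
    by apply: (@dotv_cvg _ _ _ (nbhs x)); [exact: cvg_cst|exact: cvg_id].
  exists ([set y | dotv p y < support_fun K p - d],
          [set k : nat | dotv v v / d < k%:R]); last first.
    move=> [y k] [/= + + yuk]; rewrite yuk ltr_pdivrMr// => uk kd.
    have := reg k; have := dotv_ge0 (u k); have := dotv_ge0 v => v0 u0.
    have k0 : (0 : R) <= k%:R by [].
    have : k%:R * d <= k%:R * (support_fun K p - dotv p (u k)).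
      by apply: ler_wpM2l => //; lra.
    have : 0 <= k%:R * d by rewrite mulr_ge0// ltW.
    lra.
  split.
    by apply: (cvgr_lt _ nx); rewrite /d; lra.
  exact: nbhs_infty_gtr.
apply: filterS => k Ck; rewrite leNgt; apply/negP => kv.
by apply: (Ck (u k)) => //; split => //=; exact: ltW.
Qed.

End support_function.

(** * Lebesgue measure on tuples *)

Section tuple_measure.
Context {R : realType}.
Local Notation RB := (measurableTypeR R).
Local Notation row := (@row_of_tuple R _).

Definition rat_box m (c : 'rV[rat]_m * rat) : set (m.-tuple RB) :=
  [set t | forall i, `|tnth t i - ratr (c.1 ord0 i)| < ratr c.2].

Lemma measurable_rat_box m c : measurable (@rat_box m c).
Proof.
rewrite (_ : rat_box c =
    \bigcap_i [set t | `|tnth t i - ratr (c.1 ord0 i)| < ratr c.2]); last first.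
  by apply/seteqP; split => t tc i => [_|]; exact: tc.
apply: fin_bigcap_measurable => // i _.
have mf : measurable_fun setT
    (fun t : m.-tuple RB => `|tnth t i - ratr (c.1 ord0 i)| : R).
  apply: measurableT_comp => //; apply: measurable_funB => //.
  exact: measurable_tnth.
rewrite (_ : [set _ | _] =
    setT `&` (fun t : m.-tuple RB => `|tnth t i - ratr (c.1 ord0 i)| : R)
      @^-1` `]-oo, ratr c.2[%classic).
  by apply: mf => //; exact: measurable_itv.
by rewrite setTI; apply/seteqP; split => t /=; rewrite in_itv.
Qed.

(** The sigma-algebra of tuples is generated by the coordinates, while open
sets of rows come from a topology; the link is that an open set is a countable
union of boxes with rational centres and radii. *)
Lemma measurable_preimage_row m (A : set 'rV[R]_m) :
  open A -> measurable (row @^-1` A).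
Proof.
move=> oA; pose F c := if `[< @rat_box m c `<=` row @^-1` A >] then
  rat_box c else set0.
rewrite (_ : _ @^-1` _ = \bigcup_c F c).
  apply: countable_bigcupT_measurable; first by exact: countableP.
  by move=> c; rewrite /F; case: ifP => // _; exact: measurable_rat_box.
apply/seteqP; split => [t At|t [c _]]; last first.
  by rewrite /F; case: ifP => // /asboolP cA /cA.
have := oA; rewrite openE => /(_ _ At)/nbhs_ballP[e /= e0 eA].
have /rat_in_itvoo[q] : 0 < e / 2 by rewrite divr_gt0.
rewrite in_itv/= => /andP[q0 qe].
have cP i : {r : rat | `|tnth t i - ratr r| < ratr q}.
  have /rat_in_itvoo : tnth t i - ratr q < tnth t i + ratr q :> R by lra.
  move=> /cid[r]; rewrite in_itv/= => /andP[r1 r2]; exists r.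
  by rewrite ltr_norml; apply/andP; split; lra.
exists (\row_i sval (cP i), q) => //; rewrite /F; case: asboolP => [_ i|].
  by rewrite /= mxE; exact: (svalP (cP i)).
move=> h; exfalso; apply: h => s st; apply: eA; split => // i j.
rewrite ord1 {i} !mxE /ball/=.
have := st j; have := svalP (cP j); rewrite /= mxE.
rewrite !ltr_norml => /andP[h1 h2] /andP[h3 h4].
by apply/andP; split; lra.
Qed.

Lemma measurable_comp_row m (f : 'rV[R]_m -> R) : continuous f ->
  measurable_fun setT (f \o row).
Proof.
move=> cf; apply: (measurability _ (RGenInftyO.measurableE R)) => //.
move=> _ [_ [x ->] <-]; rewrite setTI comp_preimage.
by apply: measurable_preimage_row; apply: open_comp => //.
Qed.

(** Fubini's theorem in the direction [i], for a set that every line parallel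
to the [i]-th axis meets in at most one point. The measure is built by peeling
off the first coordinate: if [i] is that coordinate the other order of
integration is used, otherwise almost every section is null by induction. *)
Lemma lebesgue_tuple_null m (i : 'I_m) (A : set (m.-tuple RB)) : measurable A ->
  (forall t s, A t -> A s -> (forall j, j != i -> tnth t j = tnth s j) ->
     tnth t i = tnth s i) ->
  lebesgue_tuple m A = 0%E.
Proof.
elim: m i A => [[]//|m IH] i A mA linesA.
have mB : measurable (@cons_pair R m @^-1` A).
  by rewrite -[X in measurable X]setTI; exact: measurable_cons_pair.
rewrite /= /lebesgue_cons /pushforward.
set B := _ @^-1` _ in mB *.
case: (unliftP ord0 i) => [j ij|i0].
  apply: integral0_eq => x _ /=; apply: (IH j).
    exact: measurable_xsection.
  move=> t s; rewrite /xsection/= !inE => Bt Bs ts.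
  have := linesA _ _ Bt Bs; rewrite ij /cons_pair/= !tnthS; apply => k.
  case: (unliftP ord0 k) => [l ->|-> _]; last by rewrite !tnth0.
  by rewrite (inj_eq lift_inj) !tnthS; exact: ts.
rewrite (@product_measure_unique _ _ _ _ _ _ _
  ((@lebesgue_measure R) \x^ (lebesgue_tuple m))%E)//; last first.
  by move=> X Y mX mY; exact: product_measure2E.
apply: integral0_eq => y _ /=.
have [->|/set0P[s /ysectionP Bs]] := eqVneq (ysection B y) set0.
  exact: measure0.
suff -> : ysection B y = [set s] by exact: lebesgue_measure_set1.
apply/seteqP; split => [t /ysectionP Bt|_ ->]; last exact/ysectionP.
have := linesA _ _ Bt Bs; rewrite i0 /cons_pair/= !tnth0; apply => k.
by case: (unliftP ord0 k) => [l -> _|->]; rewrite ?tnthS// eqxx.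
Qed.

Lemma measurable_cube m (a : R) :
  measurable [set t : m.-tuple RB | forall i, `|tnth t i| <= a].
Proof.
rewrite (_ : [set _ | _] = \bigcap_i [set t | `|tnth t i| <= a]); last first.
  by apply/seteqP; split => t ta i => [_|]; exact: ta.
apply: fin_bigcap_measurable => // i _.
rewrite (_ : [set _ | _] =
    setT `&` (fun t : m.-tuple RB => `|tnth t i| : R) @^-1` `]-oo, a]%classic).
  have : measurable_fun setT (fun t : m.-tuple RB => `|tnth t i| : R).
    by apply: measurableT_comp => //; exact: measurable_tnth.
  by apply => //; exact: measurable_itv.
by rewrite setTI; apply/seteqP; split => t /=; rewrite in_itv.
Qed.

Lemma lebesgue_tuple_cube_lty m (a : R) :
  (lebesgue_tuple m [set t : m.-tuple RB | forall i, (`|tnth t i| <= a)%R]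
    < +oo)%E.
Proof.
elim: m => [|m IH].
  by rewrite /= (le_lt_trans (probability_le1 _ _)) ?ltry//; exact: measurable_cube.
rewrite /= /lebesgue_cons /pushforward.
rewrite (_ : _ @^-1` _ = [set x | (`|x| <= a)%R] `*`
    [set t : m.-tuple RB | forall i, (`|tnth t i| <= a)%R]); last first.
  apply/seteqP; split => -[x t] /= => [xt|[xa ta] i].
    split => [|i]; first by have := xt ord0; rewrite tnth0.
    by have := xt (lift ord0 i); rewrite tnthS.
  by case: (unliftP ord0 i) => [j ->|->]; rewrite ?tnthS ?tnth0.
have -> : [set x : RB | (`|x| <= a)%R] = `[- a, a]%classic.
  by apply/seteqP; split => x /=; rewrite in_itv/= ler_norml.
rewrite product_measure1E//; [|exact: measurable_cube].
apply: lte_mul_pinfty => //.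
have := @lebesgue_measure_itv R `[- a, a]; rewrite /= => ->.
by case: ifP.
Qed.

Lemma measurable_unit_ball m : measurable (@unit_ball R m).
Proof.
rewrite -[X in measurable X]setCK; apply: measurableC.
rewrite /unit_ball preimage_setC; apply: measurable_preimage_row.
exact/closed_openC/eball_closed.
Qed.

Lemma unit_ball_lty m : (lebesgue_tuple m (@unit_ball R m) < +oo)%E.
Proof.
apply: le_lt_trans (lebesgue_tuple_cube_lty m 1); apply: le_measure.
- by rewrite inE; exact: measurable_unit_ball.
- by rewrite inE; exact: measurable_cube.
move=> t; rewrite /unit_ball /eball/= subr0 => t1 i.
by have := coord_le_enorm (row t) i; rewrite mxE => /le_trans; exact.
Qed.

End tuple_measure.

(** * Kinks of a function along the coordinate axes *)

Section kinks.
Context {R : realType} {m : nat}.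
Implicit Types (p : 'rV[R]_m) (g : 'rV[R]_m -> R) (i : 'I_m).
Local Notation e_ i := (delta_mx ord0 i : 'rV[R]_m).

(** The points where the slopes of [g] along the [i]-th axis jump over the
interval [[q, r]]. All the steps [h] are quantified, rather than the limits of
the difference quotients, because this makes the set closed. *)
Definition kink g i (q r : R) : set 'rV[R]_m := [set p | forall h, 0 < h ->
  g p - g (p - h *: e_ i) <= q * h /\ r * h <= g (p + h *: e_ i) - g p].

Lemma subdifferential_coord g p v i h : subdifferential g p v -> 0 < h ->
  g p - g (p - h *: e_ i) <= v ord0 i * h /\
  v ord0 i * h <= g (p + h *: e_ i) - g p.
Proof.
move=> gv h0; have := gv (p - h *: e_ i); have := gv (p + h *: e_ i).
rewrite !(addrC p) !addrK !dotvE dotvC dotv_delta; split; lra.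
Qed.

(** By the subgradient inequality the difference quotients of [g] to the left of
[p] are at most [v ord0 i]. Take rationals [q < r] slightly above this number:
as [p] is not a kink, some difference quotient of [g] to the right of [p] is
below [r]. For large [k] the same holds of [g_ k], where it bounds the [i]-th
coordinate of every subgradient at [p]. The lower bound is symmetric. *)
Lemma subdifferential_coord_cvg (g_ : nat -> 'rV[R]_m -> R) g p
    (v_ : nat -> 'rV[R]_m) v i :
  (forall q, g_ k q @[k --> \oo] --> g q) ->
  (forall k, subdifferential (g_ k) p (v_ k)) -> subdifferential g p v ->
  (forall q r : rat, q < r -> ~ kink g i (ratr q) (ratr r) p) ->
  v_ k ord0 i @[k --> \oo] --> v ord0 i.
Proof.
move=> g_g g_v gv nk; apply/cvgrPdist_le => e e0.
have /rat_in_itvoo[r1] : v ord0 i < v ord0 i + e by lra.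
rewrite in_itv/= => /andP[vr1 r1e].
have /rat_in_itvoo[q1] : v ord0 i < ratr r1 by [].
rewrite in_itv/= => /andP[vq1 q1r1].
have /rat_in_itvoo[q2] : v ord0 i - e < v ord0 i by lra.
rewrite in_itv/= => /andP[q2e q2v].
have /rat_in_itvoo[r2] : ratr q2 < v ord0 i by [].
rewrite in_itv/= => /andP[q2r2 r2v].
rewrite !ltr_rat in q1r1 q2r2.
have [h1 [h10 up]] : exists h, 0 < h /\ g (p + h *: e_ i) - g p < ratr r1 * h.
  have /existsNP[h /not_implyP[h0 b]] := nk _ _ q1r1.
  exists h; split => //; rewrite ltNge; apply/negP => le; apply: b; split => //.
  have [+ _] := subdifferential_coord i gv h0; move=> /le_trans; apply.
  by rewrite ler_pM2r// ltW.
have [h2 [h20 dn]] : exists h, 0 < h /\ ratr q2 * h < g p - g (p - h *: e_ i).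
  have /existsNP[h /not_implyP[h0 b]] := nk _ _ q2r2.
  exists h; split => //; rewrite ltNge; apply/negP => le; apply: b; split => //.
  have [_] := subdifferential_coord i gv h0; apply/le_trans.
  by rewrite ler_pM2r// ltW.
have near1 : \forall k \near \oo, g_ k (p + h1 *: e_ i) - g_ k p < ratr r1 * h1.
  have c : g_ k (p + h1 *: e_ i) - g_ k p @[k --> \oo] -->
      g (p + h1 *: e_ i) - g p by apply: cvgB.
  exact: (cvgr_lt _ c).
have near2 : \forall k \near \oo, ratr q2 * h2 < g_ k p - g_ k (p - h2 *: e_ i).
  have c : g_ k p - g_ k (p - h2 *: e_ i) @[k --> \oo] -->
      g p - g (p - h2 *: e_ i) by apply: cvgB.
  exact: (cvgr_gt _ c).
apply: filterS2 near1 near2 => k k1 k2.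
have [_ u1] := subdifferential_coord i (g_v k) h10.
have [u2 _] := subdifferential_coord i (g_v k) h20.
have := le_lt_trans u1 k1; have := lt_le_trans k2 u2.
by rewrite !ltr_pM2r// ler_norml => ? ?; apply/andP; split; lra.
Qed.

Lemma kink_closed g i q r : continuous g -> closed (kink g i q r).
Proof.
move=> cg.
have cgs (u : 'rV[R]_m) : continuous (fun p => g (p + u)).
  move=> p; apply: (cvg_comp (fun p => p + u) g); last exact: cg.
  by apply: (@cvgD _ _ _ (nbhs p)); [exact: cvg_id|exact: cvg_cst].
rewrite (_ : kink g i q r = \bigcap_(h in [set h | 0 < h])
  ([set p | g p - g (p - h *: e_ i) <= q * h] `&`
   [set p | r * h <= g (p + h *: e_ i) - g p])).
  apply: closed_bigI => h _; apply: closedI; apply: closed_lef.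
  - by move=> p; apply: (@cvgB _ _ _ (nbhs p)); [exact: cg|exact: (cgs (- (h *: e_ i)))].
  - exact: cst_continuous.
  - exact: cst_continuous.
  - by move=> p; apply: (@cvgB _ _ _ (nbhs p)); [exact: (cgs (h *: e_ i))|exact: cg].
by apply/seteqP; split.
Qed.

(** Two kinks [t] and [s = t + h e_i] on one line would give
[r * h <= g s - g t <= q * h]. *)
Lemma kink_null g i q r : continuous g -> q < r ->
  (lebesgue_tuple m).-negligible (row_of_tuple @^-1` kink g i q r).
Proof.
move=> cg qr.
have mk : measurable (@row_of_tuple R m @^-1` kink g i q r).
  rewrite -[X in measurable X]setCK preimage_setC; apply: measurableC.
  by apply: measurable_preimage_row; exact/closed_openC/kink_closed.
apply/negligibleP => //; apply: (@lebesgue_tuple_null _ _ i) => // t s.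
wlog ts : t s / tnth t i <= tnth s i => [wl kt ks ts|].
  have [|/ltW] := leP (tnth t i) (tnth s i); first by move=> /wl; apply.
  by move=> /wl st; apply/esym/st => // j /ts.
move=> kt ks tsE; apply/eqP; rewrite eq_le ts/= leNgt; apply/negP => lts.
pose h := tnth s i - tnth t i; have h0 : 0 < h by rewrite subr_gt0.
have sE : row_of_tuple s = row_of_tuple t + h *: e_ i.
  apply/rowP => j; rewrite !mxE eqxx/=; have [->|ji] := eqVneq j i.
    by rewrite mulr1 addrC subrK.
  by rewrite mulr0 addr0 tsE.
have [_] := kt _ h0; have [+ _] := ks _ h0; rewrite sE addrK.
by move=> le1 /le_trans/(_ le1); rewrite ler_pM2r// leNgt qr.
Qed.

End kinks.

(** * Steiner points *)

Section steiner_point.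
Context {R : realType} {m : nat}.
Implicit Types (x u : 'rV[R]_m) (K : set 'rV[R]_m) (i : 'I_m).
Local Notation RB := (measurableTypeR R).
Local Notation mu := (@lebesgue_tuple R m).
Local Notation row := (@row_of_tuple R m).
Local Notation sel K p := (min_norm (subdifferential (support_fun K) p)).

Lemma measurable_min_norm_support K i :
  compact K -> convex_set K -> K !=set0 ->
  measurable_fun setT (fun t : m.-tuple RB => sel K (row t) ord0 i).
Proof.
move=> cK cvK K0; have clK : closed K by exact: compact_closed.
apply: (@measurable_fun_cvg _ _ _ _
  (fun k : nat => (fun p => nearest K (k%:R *: p) ord0 i) \o row)) => [k|t _].
  apply: measurable_comp_row => p.
  apply: (cvg_comp (fun p => nearest K (k%:R *: p)) (fun x => x ord0 i));
    last exact: coord_continuous.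
  apply: (cvg_comp (fun p => k%:R *: p) (nearest K)); last exact: nearest_continuous.
  exact: scaler_continuous.
apply: (cvg_comp (fun k : nat => nearest K (k%:R *: row t)) (fun x => x ord0 i));
  last exact: coord_continuous.
exact: nearest_cvg_min_norm.
Qed.

Lemma integrable_min_norm_support K i :
  compact K -> convex_set K -> K !=set0 ->
  mu.-integrable (@unit_ball R m) (EFin \o (fun t => sel K (row t) ord0 i)).
Proof.
move=> cK cvK K0; apply: measurable_bounded_integrable.
- exact: measurable_unit_ball.
- exact: unit_ball_lty.
- exact: measurable_funTS (measurable_min_norm_support i cK cvK K0).
have [M M0 KM] := compact_enorm_le cK.
exists M; split => [|N /ltW MN t _ /=]; first exact: num_real.
rewrite (le_trans (coord_le_enorm _ _))// (le_trans _ MN)// KM//.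
exact: min_norm_support_mem.
Qed.

(** The Steiner point is an average of points of [K] and so it stays in every
half-space that contains [K]. The assumption [0 <= c] settles the case of a ball
of volume [0], where the convention on inverses makes the Steiner point [0]. *)
Lemma dotv_steiner_le K u c : compact K -> convex_set K -> K !=set0 ->
  0 <= c -> (forall x, K x -> dotv u x <= c) -> dotv u (steiner K) <= c.
Proof.
move=> cK cvK K0 c0 Kc; set V := fine (mu (@unit_ball R m)).
have int i := integrable_min_norm_support i cK cvK K0.
have mB := @measurable_unit_ball R m.
have sumE (s : seq 'I_m) :
    mu.-integrable (@unit_ball R m)
      (EFin \o (fun t => \sum_(i <- s) u ord0 i * sel K (row t) ord0 i)) /\
    \sum_(i <- s) u ord0 i * \int[mu]_(t in @unit_ball R m) sel K (row t) ord0 i =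
    \int[mu]_(t in @unit_ball R m) \sum_(i <- s) u ord0 i * sel K (row t) ord0 i.
  elim: s => [|i s [ints IH]].
    split.
      under eq_fun do rewrite big_nil.
      exact: integrable0.
    rewrite big_nil; under eq_Rintegral do rewrite big_nil.
    by rewrite Rintegral_cst// mul0r.
  have inti : mu.-integrable (@unit_ball R m)
      (EFin \o (fun t => u ord0 i * sel K (row t) ord0 i)).
    exact: (integrableZl mB (u ord0 i) (int i)).
  split.
    under eq_fun do rewrite big_cons.
    exact: (integrableD mB inti ints).
  rewrite big_cons IH -RintegralZl// -RintegralD//.
  by apply: eq_Rintegral => t _; rewrite big_cons.
have [intu uE] := sumE (index_enum 'I_m).
have -> : dotv u (steiner K) = V^-1 *
    \int[mu]_(t in @unit_ball R m) dotv u (sel K (row t)).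
  rewrite /dotv -uE mulr_sumr; apply: eq_bigr => i _.
  by rewrite mxE mulrCA.
have V0 : 0 <= V by exact: fine_ge0.
have le : \int[mu]_(t in @unit_ball R m) dotv u (sel K (row t)) <= c * V.
  rewrite -Rintegral_cst//; apply: le_Rintegral => //.
    apply: measurable_bounded_integrable => //; first exact: unit_ball_lty.
    exists c; split => [|N cN t _ /=]; first exact: num_real.
    by rewrite ger0_norm// ltW.
  by move=> t _; apply: Kc; exact: min_norm_support_mem.
have [->|V1] := eqVneq V 0; first by rewrite invr0 mul0r.
by rewrite ler_pdivrMl ?lt_neqAle ?V0 1?eq_sym ?V1// mulrC.
Qed.

(** Dominated convergence. Off the kinks of the limiting support function, hence
almost everywhere, the subgradients converge coordinatewise; they are bounded
because they are points of the sets [K_ k]. *)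
Lemma steiner_cvg (K_ : nat -> set 'rV[R]_m) K M :
  (forall k, [/\ compact (K_ k), convex_set (K_ k) & K_ k !=set0]) ->
  [/\ compact K, convex_set K & K !=set0] ->
  (forall k x, K_ k x -> enorm x <= M) ->
  (forall p, support_fun (K_ k) p @[k --> \oo] --> support_fun K p) ->
  steiner (K_ k) @[k --> \oo] --> steiner K.
Proof.
move=> cK_ [cK cvK K0] K_M K_K.
suff cvgi i : steiner (K_ k) ord0 i @[k --> \oo] --> steiner K ord0 i.
  rewrite [steiner K]row_sum_delta.
  under eq_cvg do rewrite [steiner _]row_sum_delta.
  apply: cvg_big; [exact: add_continuous|] => i _.
  by apply: cvgZr_tmp; exact: cvgi.
rewrite mxE; under eq_cvg do rewrite mxE.
apply: cvgMr.
have mB := @measurable_unit_ball R m.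
pose F (c : rat * rat) : set (m.-tuple RB) := if c.1 < c.2 then
  row @^-1` kink (support_fun K) i (ratr c.1) (ratr c.2) else set0.
have Fnull c : mu.-negligible (F c).
  rewrite /F; case: ifPn => [c12|_]; last exact: negligible_set0.
  by apply: kink_null; [exact: support_continuous|rewrite ltr_rat].
have bad : mu.-negligible (\bigcup_k oapp F set0 (unpickle k)).
  apply: negligible_bigcup => k.
  by case: (unpickle k) => [c|] /=; [exact: Fnull|exact: negligible_set0].
have int k := let: And3 a b c := cK_ k in integrable_min_norm_support i a b c.
have intK := integrable_min_norm_support i cK cvK K0.
have [] := @dominated_convergence _ _ _ mu (@unit_ball R m) mB
  (fun k t => (sel (K_ k) (row t) ord0 i)%:E)
  (fun t => (sel K (row t) ord0 i)%:E) (cst M%:E).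
- by move=> k; apply: measurable_int (int k).
- exact: measurable_int intK.
- apply: negligibleS bad => t /= nt; apply: contrapT => nF; apply: nt => _.
  apply/fine_cvgP; split; first exact: nearW.
  apply: (@subdifferential_coord_cvg _ _ (fun k => support_fun (K_ k))
    (support_fun K) (row t) (fun k => sel (K_ k) (row t))).
  + exact: K_K.
  + move=> k; have [a b c] := cK_ k.
    by have [] := min_norm_supportP (row t) a b c.
  + by have [] := min_norm_supportP (row t) cK cvK K0.
  move=> q r qr kt; apply: nF; exists (pickle (q, r)); first exact: I.
  by rewrite pickleK /F/= qr.
- apply: measurable_bounded_integrable => //; first exact: unit_ball_lty.
  exact: bounded_cst.
- apply: aeW => t k _ /=; rewrite lee_fin.
  rewrite (le_trans (coord_le_enorm _ _))// (K_M k)//.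
  by have [a b c] := cK_ k; exact: min_norm_support_mem.
by move=> _ _; rewrite -(fineK (integrable_fin_num mB intK)) => /fine_cvg.
Qed.

End steiner_point.

(** * Truncation of converging convex sets *)

Section truncation.
Context {R : realType} {m : nat}.
Implicit Types (x y a p : 'rV[R]_m) (E : set 'rV[R]_m).

Definition truncation E a := E `&` eball a (2 * Defs.edist a E).

(** Convergence in the sense of Painleve and Kuratowski. The upper half is stated
with neighbourhoods instead of limits of subsequences: compactness turns it into
the eventual disjointness of [E_ k] from any compact set that misses [E]. *)
Definition kuratowski_cvg (E_ : nat -> set 'rV[R]_m) E :=
  (forall x, E x -> forall e, 0 < e ->
     \forall k \near \oo, exists2 y, E_ k y & enorm (y - x) <= e) /\
  (forall x, ~ E x -> \forall y \near x & k \near \oo, ~ E_ k y).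

Lemma edist_ge0 E a : closed E -> E !=set0 -> 0 <= Defs.edist a E.
Proof. by move=> cE E0; rewrite edist_nearest// enorm_ge0. Qed.

Lemma edist_le E a x : closed E -> E x -> Defs.edist a E <= enorm (a - x).
Proof.
move=> cE Ex; rewrite edist_nearest//; last by exists x.
by have [_] := nearestP a cE (ex_intro _ _ Ex); exact.
Qed.

Lemma eball_convex a r : convex_set (eball a r).
Proof.
apply: convex_setPI => x y s; rewrite /eball/= => xa ya /andP[s0 s1].
have -> : s *: x + (1 - s) *: y - a = s *: (x - a) + (1 - s) *: (y - a).
  by apply/rowP => i; rewrite !mxE; ring.
rewrite (le_trans (enormD _ _))// !enormZ !ger0_norm//; last by lra.
have : s * enorm (x - a) <= s * r by rewrite ler_wpM2l.
have : (1 - s) * enorm (y - a) <= (1 - s) * r by rewrite ler_wpM2l//; lra.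
lra.
Qed.

Lemma convex_setI E F : convex_set E -> convex_set F ->
  convex_set (E `&` F : set 'rV[R]_m).
Proof.
move=> cE cF; apply: convex_setPI => x y s [Ex Fx] [Ey Fy] s01.
by split; exact: convex_setE.
Qed.

Lemma truncation_nearest E a : closed E -> E !=set0 ->
  truncation E a (nearest E a).
Proof.
move=> cE E0; have [Ey _] := nearestP a cE E0; split => //.
rewrite /eball/= enormBC -edist_nearest//.
by have := edist_ge0 a cE E0; lra.
Qed.

Lemma truncation_closed E a : closed E -> closed (truncation E a).
Proof. by move=> cE; apply: closedI; [exact: cE|exact: eball_closed]. Qed.

Lemma truncation_body E a : closed E -> convex_set E -> E !=set0 ->
  [/\ compact (truncation E a), convex_set (truncation E a) &
      truncation E a !=set0].
Proof.
move=> cE cvE E0; split.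
- apply: (@closed_bounded_compact _ _ _ a (2 * Defs.edist a E)).
    exact: truncation_closed.
  by move=> x [].
- by apply: convex_setI => //; exact: eball_convex.
- by exists (nearest E a); exact: truncation_nearest.
Qed.

Section convergence.
Variables (E_ : nat -> set 'rV[R]_m) (E : set 'rV[R]_m).
Variables (a_ : nat -> 'rV[R]_m) (a : 'rV[R]_m).
Hypothesis E_P : forall k, [/\ closed (E_ k), convex_set (E_ k) & E_ k !=set0].
Hypothesis EP : [/\ closed E, convex_set E & E !=set0].
Hypothesis E_E : kuratowski_cvg E_ E.
Hypothesis a_a : a_ k @[k --> \oo] --> a.

(** From above by the points of [E_ k] that approximate the point of [E] nearest
to [a]; from below because a smaller concentric ball misses [E], hence
eventually [E_ k]. *)
Lemma edist_cvg :
  Defs.edist (a_ k) (E_ k) @[k --> \oo] --> Defs.edist a E.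
Proof.
have [cE _ E0] := EP; have [EL EU] := E_E.
apply/cvgrPdist_le => e e0; have e2 : 0 < e / 2 by rewrite divr_gt0.
set d := Defs.edist a E.
have [Ey _] := nearestP a cE E0.
have near3 : \forall k \near \oo, eball a (d - e / 2) `<=` ~` E_ k.
  apply: (iffLR (compact_near_coveringP _) (@eball_compact _ _ a (d - e / 2))
    _ _ (fun k x => ~ E_ k x)) => x xa; apply: EU => Ex.
  have := edist_le a cE Ex; move: xa; rewrite /eball/= (enormBC x) -/d; lra.
apply: filterS3 (near_enorm a_a e2) (EL _ Ey _ e2) near3 => k ka [y Eky yn] kC.
have [cEk _ Ek0] := E_P k.
have up := edist_le (a_ k) cEk Eky.
have up1 := enorm_triangle a (a_ k) y.
have up2 := enorm_triangle (nearest E a) a y.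
have dE := edist_nearest a cE E0; rewrite -/d in dE.
have [Eky' _] := nearestP (a_ k) cEk Ek0.
have lo : d - e / 2 < enorm (a - nearest (E_ k) (a_ k)).
  by rewrite ltNge enormBC; apply/negP => /kC; apply.
have lo1 := enorm_triangle (a_ k) a (nearest (E_ k) (a_ k)).
have dk := edist_nearest (a_ k) cEk Ek0.
rewrite enormBC in yn; rewrite (enormBC a (a_ k)) in lo1.
by rewrite ler_norml; apply/andP; split; lra.
Qed.

Lemma truncation_bounded :
  exists M, forall k x, truncation (E_ k) (a_ k) x -> enorm x <= M.
Proof.
have c : enorm (a_ k) + 2 * Defs.edist (a_ k) (E_ k) @[k --> \oo] -->
    enorm a + 2 * Defs.edist a E.
  by apply: cvgD; [exact: enorm_cvg|apply: cvgMr; exact: edist_cvg].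
have [N [_ /(_ (N + 1))]] := cvg_seq_bounded (cvgP _ c).
rewrite ltrDl => /(_ ltr01) bN; exists (N + 1) => k x [_].
rewrite /eball/= => xa; rewrite (le_trans _ (bN k I))//.
rewrite (le_trans _ (ler_norm _))// -(subrK (a_ k) x) (le_trans (enormD _ _))//.
by rewrite addrC lerD2l.
Qed.

(** A point [x] of the truncation is first moved to [z], a little closer to the
point of [E] nearest to [a]: there the constraint [|z - a| <= 2 d] has the
slack [s * d], which absorbs the variations of the centre, of the radius and of
the set. If [d = 0] there is no slack, but then the truncations shrink to
[a]. *)
Lemma truncation_approx x : truncation E a x -> forall e, 0 < e ->
  \forall k \near \oo,
    exists2 y, truncation (E_ k) (a_ k) y & enorm (y - x) <= e.
Proof.
have [cE cvE E0] := EP; have [EL _] := E_E.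
move=> [Ex]; rewrite /eball/= => xa e e0.
have [Ey _] := nearestP a cE E0; set y := nearest E a in Ey.
have ya : Defs.edist a E = enorm (a - y) by exact: edist_nearest.
set d := Defs.edist a E in xa ya; have d0 : 0 <= d by exact: edist_ge0.
have [dz|dN0] := eqVneq d 0.
  have e3 : 0 < e / 3 by rewrite divr_gt0.
  have nd : \forall k \near \oo, Defs.edist (a_ k) (E_ k) < e / 3.
    by apply: (cvgr_lt _ edist_cvg); rewrite -/d dz.
  apply: filterS2 (near_enorm a_a e3) nd => k ka kd.
  have [cEk _ Ek0] := E_P k; exists (nearest (E_ k) (a_ k)).
    exact: truncation_nearest.
  have := edist_nearest (a_ k) cEk Ek0; rewrite enormBC.
  have := enorm_triangle (a_ k) (nearest (E_ k) (a_ k)) x.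
  have := enorm_triangle a (a_ k) x; rewrite (enormBC a x); lra.
have {dN0}d0 : 0 < d by rewrite lt_neqAle eq_sym dN0.
(* [|y - x| <= 3 d], so this [s] moves [x] by at most [e / 2]. *)
pose s := e / (e + 6 * d).
have s0 : 0 < s by rewrite divr_gt0// addr_gt0// mulr_gt0.
have sE : s * (e + 6 * d) = e by rewrite /s; field; lra.
have se0 : 0 < s * e by rewrite mulr_gt0.
have sd0 : 0 < s * d by rewrite mulr_gt0.
have s1 : s <= 1 by rewrite -(ler_pM2r d0); nra.
pose z := s *: y + (1 - s) *: x.
have Ez : E z by apply: convex_setE => //; rewrite s1 ltW.
have za : enorm (z - a) <= 2 * d - s * d.
  have -> : z - a = s *: (y - a) + (1 - s) *: (x - a).
    by apply/rowP => i; rewrite !mxE; ring.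
  rewrite (le_trans (enormD _ _))// !enormZ !ger0_norm ?subr_ge0//; last exact: ltW.
  rewrite (enormBC y) -ya.
  have : (1 - s) * enorm (x - a) <= (1 - s) * (2 * d) by rewrite ler_wpM2l ?subr_ge0.
  lra.
have zx : enorm (z - x) <= 3 * (s * d).
  have -> : z - x = s *: (y - x) by apply/rowP => i; rewrite !mxE; ring.
  rewrite enormZ ger0_norm ?(ltW s0)// mulrCA ler_wpM2l ?(ltW s0)//.
  rewrite (le_trans (enorm_triangle a _ _))// (enormBC y) -ya (enormBC a); lra.
have h0 : 0 < s * d / 4 by rewrite divr_gt0.
have nd : \forall k \near \oo, d - s * d / 4 < Defs.edist (a_ k) (E_ k).
  by apply: (cvgr_gt _ edist_cvg); rewrite -/d; lra.
apply: filterS3 (near_enorm a_a h0) (EL _ Ez _ h0) nd => k ka [w Ekw wz] kd.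
exists w.
  split => //; rewrite /eball/= (le_trans (enorm_triangle z _ _))//.
  have := enorm_triangle a z (a_ k); rewrite (enormBC a (a_ k)); lra.
rewrite (le_trans (enorm_triangle z _ _))//; lra.
Qed.

(** The upper bound is compactness: the points of a large ball where [<p, .>]
exceeds its maximum over the truncation of [E] lie off [E] or off the ball of
radius [2 d], so eventually they lie off the truncation of [E_ k]. *)
Lemma support_truncation_cvg p :
  support_fun (truncation (E_ k) (a_ k)) p @[k --> \oo] -->
  support_fun (truncation E a) p.
Proof.
have [cE cvE E0] := EP; have [EL EU] := E_E.
have [cK cvK K0] := truncation_body a cE cvE E0.
have body k : [/\ compact (truncation (E_ k) (a_ k)),
    convex_set (truncation (E_ k) (a_ k)) & truncation (E_ k) (a_ k) !=set0].
  by have [? ? ?] := E_P k; exact: truncation_body.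
set s := support_fun _ p.
have [M KM] := truncation_bounded.
apply/cvgrPdist_le => e e0.
have upper : \forall k \near \oo,
    support_fun (truncation (E_ k) (a_ k)) p <= s + e.
  pose C := eball 0 M `&` [set x | s + e <= dotv p x].
  have cC : compact C.
    apply: (@closed_bounded_compact _ _ _ 0 M) => [|x []//].
    apply: closedI; first exact: eball_closed.
    by apply: closed_lef; [exact: cst_continuous|exact: dotv_continuous].
  have : \forall k \near \oo, C `<=` ~` truncation (E_ k) (a_ k).
    apply: (iffLR (compact_near_coveringP _) cC
      _ _ (fun k x => ~ truncation (E_ k) (a_ k) x)) => x [_ /= xs].
    have [Ex|nEx] := pselect (E x); last first.
      have [[A B] AB nE] := EU _ nEx; exists (A, B) => // -[y k] /nE /= nEky [].
      by move=> /nEky.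
    have xa : 2 * Defs.edist a E < enorm (x - a).
      rewrite ltNge; apply/negP => xa.
      by have := support_ge p cK (conj Ex xa); rewrite -/s; lra.
    pose d := (enorm (x - a) - 2 * Defs.edist a E) / 2.
    have d0 : 0 < d by rewrite divr_gt0// subr_gt0.
    have d3 : 0 < d / 3 by rewrite divr_gt0.
    have nx := near_enorm (@cvg_id _ (nbhs x)) d3.
    have na := near_enorm a_a d3.
    have nd : \forall k \near \oo,
        Defs.edist (a_ k) (E_ k) < Defs.edist a E + d / 3.
      by apply: (cvgr_lt _ edist_cvg); rewrite ltrDl.
    have nad : \forall k \near \oo, enorm (a_ k - a) < d / 3 /\
        Defs.edist (a_ k) (E_ k) < Defs.edist a E + d / 3.
      by near=> k; split; near: k; [exact: na|exact: nd].
    exists ([set y | enorm (y - x) < d / 3],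
            [set k | enorm (a_ k - a) < d / 3 /\
                     Defs.edist (a_ k) (E_ k) < Defs.edist a E + d / 3]).
      by split; [exact: nx|exact: nad].
    move=> [y k] [/= yx [ka kd]] [_]; rewrite /eball/= => yk.
    have := enorm_triangle y x a; have := enorm_triangle (a_ k) y a.
    rewrite (enormBC x y) /d in yx ka kd d0 *; lra.
  apply: filterS => k kC; apply: support_le; first by have [] := body k.
  move=> x Kx; rewrite leNgt; apply/negP => xs; apply: (kC x) => //.
  split; last exact: ltW.
  by rewrite /eball/= subr0 (KM k).
have lower : \forall k \near \oo,
    s - e <= support_fun (truncation (E_ k) (a_ k)) p.
  have [x [Ex xa] px] := support_attained p cK K0.
  have p1 : 0 < enorm p + 1 by have := enorm_ge0 p; lra.
  apply: filterS (truncation_approx (conj Ex xa) (divr_gt0 e0 p1)) => k.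
  move=> [y Ky]; rewrite ler_pdivlMr// => yx.
  have [cKk _ _] := body k; have := support_ge p cKk Ky.
  have := dotv_le p (x - y); rewrite dotvDr dotvNr px -/s (enormBC x).
  have := enorm_ge0 (y - x); lra.
apply: filterS2 upper lower => k; rewrite ler_norml => h1 h2.
by apply/andP; split; lra.
Unshelve. all: by end_near. Qed.

Lemma steiner_truncation_cvg :
  steiner (truncation (E_ k) (a_ k)) @[k --> \oo] --> steiner (truncation E a).
Proof.
have [cE cvE E0] := EP; have [M KM] := truncation_bounded.
apply: (@steiner_cvg _ _ _ _ M) => //.
- by move=> k; have [? ? ?] := E_P k; exact: truncation_body.
- exact: truncation_body.
- exact: support_truncation_cvg.
Qed.

End convergence.

End truncation.

(** * Epigraphs of conjugates of convex functions *)

Section convex_functions.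
Context {R : realType} {n : nat}.
Implicit Types (p q v : 'rV[R]_n) (h : 'rV[R]_n -> R) (e : 'rV[R]_(n + 1)).

Lemma convex_functionE h p q a : convex_function setT h -> 0 <= a <= 1 ->
  h (a *: p + (1 - a) *: q) <= a * h p + (1 - a) * h q.
Proof.
move=> cvh /andP[a0 a1].
have pT : p \in [set: convex_lmodType 'rV[R]_n] by rewrite inE.
have qT : q \in [set: convex_lmodType 'rV[R]_n] by rewrite inE.
exact: (cvh (Itv01 a0 a1) p q pT qT).
Qed.

(** The subgradient comes from minimizing [h - <v, .> + c / 2 |.|^2] at [p]. The
condition on the sphere of radius [r] confines the minimum over the whole space
to the ball, on which it exists by compactness: by convexity a value not above
the one at [0] outside of the ball would produce such a value on the sphere. It
replaces any growth assumption on [h]. *)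
Lemma subdifferential_prox h v c r : convex_function setT h -> continuous h ->
  0 <= c -> 0 < r ->
  (forall p, enorm p = r -> h 0 < h p - dotv v p + c / 2 * r ^+ 2) ->
  exists p, [/\ enorm p <= r, subdifferential h p (v - c *: p) &
    h p - dotv v p + c / 2 * dotv p p <= h 0].
Proof.
move=> cvh ch c0 r0 sphere.
pose f p := h p - dotv v p + c / 2 * dotv p p.
have f0 : f 0 = h 0 by rewrite /f !dotvE mulr0 subr0 addr0.
have cf : continuous f.
  move=> p; apply: (@cvgD _ _ _ (nbhs p)).
    by apply: (@cvgB _ _ _ (nbhs p)); [exact: ch|exact: dotv_continuous].
  apply: cvgMr; apply: (@dotv_cvg _ _ _ (nbhs p)); exact: cvg_id.
have ball0 : eball (0 : 'rV[R]_n) r 0 by rewrite /eball/= subrr enorm0 ltW.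
have [p /set_mem pr pmin] := EVT_min_rV (ex_intro _ _ ball0)
  (@eball_compact _ _ 0 r) (continuous_subspaceT cf).
have pr' : enorm p <= r by move: pr; rewrite /eball/= subr0.
have cvf q s : 0 <= s <= 1 -> f (s *: q + (1 - s) *: p) <=
    s * (h q - dotv v q) + (1 - s) * (h p - dotv v p) +
    c / 2 * dotv (s *: q + (1 - s) *: p) (s *: q + (1 - s) *: p).
  move=> s01; rewrite /f lerD2r dotvDr !dotvZr.
  by have := convex_functionE p q cvh s01; have := convex_functionE q p cvh s01; lra.
have glob q : f p <= f q.
  have [qr|qr] := leP (enorm q) r.
    by apply: pmin; apply/mem_set; rewrite /eball/= subr0.
  have q0 : 0 < enorm q by exact: lt_trans qr.
  pose s := r / enorm q; have s0 : 0 < s by rewrite divr_gt0.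
  have s1 : s <= 1 by rewrite ler_pdivrMr// mul1r ltW.
  have sq : enorm (s *: q) = r.
    by rewrite enormZ ger0_norm ?(ltW s0)// /s divfK// gt_eqF.
  have := sphere _ sq; rewrite -sq enorm_sqr !dotvE.
  have : h (s *: q) <= s * h q + (1 - s) * h 0.
    have := @convex_functionE h q 0 s cvh; rewrite scaler0 addr0; apply.
    by rewrite (ltW s0).
  have fp0 : f p <= h 0 by rewrite -f0; apply: pmin; exact: mem_set.
  move=> cv lt; rewrite (le_trans fp0)//.
  have sq2 : c / 2 * (s * (s * dotv q q)) <= c / 2 * (s * dotv q q).
    apply: ler_wpM2l; first by rewrite divr_ge0.
    rewrite -[leRHS]mul1r; apply: ler_wpM2r => //.
    by rewrite mulr_ge0 ?dotv_ge0// ltW.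
  rewrite -(ler_pM2l s0) /f; lra.
exists p; split => //; last first.
  by rewrite -f0; apply: pmin; exact: mem_set.
move=> q; rewrite -subr_le0; apply: (@le0_small _ _ (c / 2 * dotv (q - p) (q - p))).
move=> s /andP[s0 s1].
rewrite -(ler_pM2l s0).
have := le_trans (glob _) (cvf q s (introT andP (conj (ltW s0) s1))).
rewrite /f !dotvE (dotvC q p); lra.
Qed.

(** The epigraph of the Legendre conjugate of [h], written as the intersection
of the half-spaces with normals [(p, -1)]. *)
Definition epi_conjugate h : set 'rV[R]_(n + 1) :=
  [set e | forall p, dotv (row_mx p (-1)%:M) e <= h p].

Lemma dotv_row_mxE p (a : R) e :
  dotv (row_mx p a%:M) e = dotv p (lsubmx e) + a * rsubmx e ord0 ord0.
Proof.
rewrite /dotv big_split_ord/= big_ord1; congr (_ + _).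
  by apply: eq_bigr => i _; rewrite row_mxEl !mxE.
by rewrite row_mxEr !mxE eqxx mulr1n.
Qed.

Lemma epi_lagrangianE (H : R -> 'rV[R]_n -> 'rV[R]_n -> R) t x :
  epi_lagrangian H t x = epi_conjugate (H t x).
Proof.
apply/seteqP; split => e /= eE.
  move=> p; rewrite dotv_row_mxE mulN1r dotvC lerBlDr -lerBlDl -lee_fin.
  by apply: le_trans eE; apply: ereal_sup_ubound; exists p.
apply: ge_ereal_sup => _ [p _ <-]; rewrite lee_fin.
by have := eE p; rewrite dotv_row_mxE mulN1r dotvC; lra.
Qed.

Lemma epi_conjugate_closed h : closed (epi_conjugate h).
Proof.
rewrite (_ : epi_conjugate h =
  \bigcap_p [set e | dotv (row_mx p (-1)%:M) e <= h p]).
  apply: closed_bigI => p _.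
  by apply: closed_lef; [exact: dotv_continuous|exact: cst_continuous].
by apply/seteqP; split => e ee p => [_|]; exact: ee.
Qed.

Lemma epi_conjugate_convex h : convex_set (epi_conjugate h).
Proof.
apply: convex_setPI => e f s eE fE /andP[s0 s1] p; rewrite !dotvE.
have s1' : 0 <= 1 - s by rewrite subr_ge0.
have := ler_wpM2l s0 (eE p); have := ler_wpM2l s1' (fE p); lra.
Qed.

Lemma epi_conjugate_subdifferential h p v a : subdifferential h p v ->
  dotv v p - h p <= a -> epi_conjugate h (row_mx v a%:M).
Proof.
move=> hv va q; rewrite dotv_row_mxE row_mxKl row_mxKr mxE eqxx mulr1n dotvC.
by have := hv q; rewrite !dotvE; lra.
Qed.

(** A large quadratic term makes the function exceed its value at the origin on
the unit sphere, whatever the growth of [h] at infinity. *)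
Lemma epi_conjugate_neq0 h : convex_function setT h -> continuous h ->
  epi_conjugate h !=set0.
Proof.
move=> cvh ch.
have ball0 : eball (0 : 'rV[R]_n) 1 0 by rewrite /eball/= subrr enorm0.
have [p0 _ pmin] := EVT_min_rV (ex_intro _ _ ball0)
  (@eball_compact _ _ 0 1) (continuous_subspaceT ch).
pose c := 2 * (`|h 0| + `|h p0| + 1).
have [||p pr|p [_ hp _]] := @subdifferential_prox h 0 c 1 cvh ch.
- by rewrite mulr_ge0// !addr_ge0.
- by [].
- have : h p0 <= h p.
    by apply: pmin; apply/mem_set; rewrite /eball/= subr0 pr.
  rewrite dotv0l expr1n /c; have := ler_norm (h 0); have := ler_norm (- h p0).
  by rewrite normrN; lra.
by eexists; exact: (epi_conjugate_subdifferential hp (lexx _)).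
Qed.

Lemma enorm_row_mx v a : enorm (row_mx v a%:M : 'rV[R]_(n + 1)) <= enorm v + `|a|.
Proof.
rewrite -ler_sqr ?nnegrE ?addr_ge0 ?enorm_ge0// enorm_sqr dotv_row_mxE.
rewrite row_mxKl row_mxKr mxE eqxx mulr1n -enorm_sqr.
have := real_normK (num_real a); have := mulr_ge0 (enorm_ge0 v) (normr_ge0 a).
lra.
Qed.

(** The upper half is pointwise convergence, since the epigraph is given by
inequalities [<(p, -1), e> <= h p]. For the lower half, [(v, b)] in the
epigraph means that [h - <v, .>] is bounded below by [- b]; then the functions
[h_ k - <v, .> + c / 2 |.|^2] have their minimizers [p] in a fixed ball, where
[h_ k] is close to [h], and the corresponding subgradients [v - c p] are close
to [v] when [c] is small, since [c / 2 |p|^2] remains bounded. *)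
Lemma kuratowski_epi_conjugate (h_ : nat -> 'rV[R]_n -> R) h :
  (forall k, convex_function setT (h_ k)) -> (forall k, continuous (h_ k)) ->
  (forall r d, 0 < d -> \forall k \near \oo,
     forall p, enorm p <= r -> `|h_ k p - h p| <= d) ->
  kuratowski_cvg (fun k => epi_conjugate (h_ k)) (epi_conjugate h).
Proof.
move=> cvh ch h_h; split => [e eE d d0|e /existsNP[p /negP]]; last first.
  rewrite -ltNge => pe.
  pose c := (dotv (row_mx p (-1)%:M) e - h p) / 2.
  have c0 : 0 < c by rewrite divr_gt0// subr_gt0.
  exists ([set y | h p + c < dotv (row_mx p (-1)%:M) y],
          [set k | forall q, enorm q <= enorm p -> `|h_ k q - h q| <= c]).
    split; last exact: h_h.
    have c1 : h p + c < dotv (row_mx p (-1)%:M) e by rewrite /c; lra.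
    exact: (cvgr_gt _ (@dotv_continuous _ _ (row_mx p (-1)%:M) e)).
  move=> [y k] [/= yc /(_ p (lexx _))]; rewrite ler_norml => /andP[_ kc].
  by move=> /(_ p); lra.
set v := lsubmx e; set b := rsubmx e ord0 ord0.
have vb p : dotv v p - h p <= b.
  by have := eE p; rewrite dotv_row_mxE dotvC -/b; lra.
have hb : 0 <= h 0 + b by have := vb 0; rewrite dotv0r; lra.
pose M := h 0 + b + 2; have M0 : 0 < M by rewrite /M; lra.
(* [c / 2 * |p| ^+ 2 <= M] will hold at the minimizer [p], so that
[c * |p| <= Num.sqrt (2 * c * M)], which is [d / 2]. *)
pose c := d ^+ 2 / (8 * M).
have c0 : 0 < c by rewrite divr_gt0 ?exprn_gt0// mulr_gt0.
have cM : 8 * (c * M) = d ^+ 2 by rewrite /c; field; lra.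
pose r := Num.sqrt (4 * M / c).
have r0 : 0 < r by rewrite sqrtr_gt0 divr_gt0// mulr_gt0.
have r2 : c / 2 * r ^+ 2 = 2 * M.
  rewrite sqr_sqrtr; last by rewrite ltW// divr_gt0// mulr_gt0.
  by field; lra.
pose a := Num.min 1 (d / 2).
have a0 : 0 < a by rewrite lt_min ltr01 divr_gt0.
have a1 : a <= 1 by rewrite ge_min lexx.
have ad : a <= d / 2 by rewrite ge_min lexx orbT.
apply: filterS (h_h r a a0) => k ka.
have hk p : enorm p <= r -> h_ k p <= h p + a /\ h p - a <= h_ k p.
  by move=> /ka; rewrite ler_norml => /andP[? ?]; split; lra.
have [hk0 _] : h_ k 0 <= h 0 + a /\ h 0 - a <= h_ k 0.
  by apply: hk; rewrite enorm0 ltW.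
have [||p pr|p [pr hp pmin]] := @subdifferential_prox (h_ k) v c r (cvh k) (ch k).
- exact: ltW.
- exact: r0.
- have [|_ kp] := hk p; first by rewrite pr.
  by have := vb p; rewrite r2 /M; lra.
have [_ kp] := hk p pr.
exists (row_mx (v - c *: p) (b + a)%:M).
  apply: (epi_conjugate_subdifferential hp).
  have := vb p; have := dotv_ge0 p; rewrite !dotvE => p0 vp.
  have := mulr_ge0 (ltW c0) p0; lra.
have -> : row_mx (v - c *: p) (b + a)%:M - e = row_mx (- (c *: p)) a%:M.
  have -> : e = row_mx v b%:M.
    by rewrite -[LHS]hsubmxK [rsubmx e]mx11_scalar.
  rewrite opp_row_mx add_row_mx addrAC subrr add0r; congr row_mx.
  by apply/rowP => i; rewrite !mxE !ord1 eqxx !mulr1n; ring.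
rewrite (le_trans (enorm_row_mx _ _))// enormN enormZ !ger0_norm ?(ltW c0) ?(ltW a0)//.
suff : c * enorm p <= d / 2 by lra.
have cp0 : 0 <= c * enorm p := mulr_ge0 (ltW c0) (enorm_ge0 p).
rewrite -ler_sqr ?nnegrE ?divr_ge0 ?(ltW d0)//.
rewrite exprMn enorm_sqr.
have pM : c / 2 * dotv p p <= M by have := vb p; rewrite /M; lra.
have -> : (d / 2) ^+ 2 = 2 * (c * M) by rewrite expr_div_n -cM; field.
have := ler_wpM2l (ltW c0) pM; lra.
Qed.

End convex_functions.

(** * Convergence and bounds of the representations *)

Section convergence_of_representations.
Context {R : realType} {n : nat}.
Implicit Types (T : R) (h : 'rV[R]_n -> R) (H : R -> 'rV[R]_n -> 'rV[R]_n -> R).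

Lemma uniform_cvg_normP (U : choiceType) (V : normedModType R) (K : set U)
    (f_ : nat -> U -> V) (f : U -> V) :
  {uniform K, f_ @ \oo --> f} <->
  forall e, 0 < e -> \forall i \near \oo, forall y, K y -> `|f_ i y - f y| <= e.
Proof.
split => [fK e e0|fK P /uniform_nbhs[E [entE EP]]].
  have : \forall i \near \oo, [set g | forall y, K y -> ball (f y) e (g y)] (f_ i).
    apply: fK; apply/uniform_nbhs; exists [set xy | ball xy.1 e xy.2]; split => //.
    exact: (entourage_ball _ (PosNum e0)).
  apply: filterS => i fi y Ky; have := fi y Ky.
  by rewrite -ball_normE/= distrC => /ltW.
move: entE; rewrite -entourage_ballE => -[e /= e0 eE].
have e2 : 0 < e / 2 by rewrite divr_gt0.
apply: filterS (fK _ e2) => i fi; apply: EP => y Ky; apply: eE => /=.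
rewrite -ball_normE/= distrC (le_lt_trans (fi y Ky))//; lra.
Qed.

Lemma rep_eE H t x a :
  rep_e H t x a = steiner (truncation (epi_conjugate (H t x)) a).
Proof. by rewrite /rep_e epi_lagrangianE. Qed.

Lemma epi_conjugate_body h : convex_function setT h -> continuous h ->
  [/\ closed (epi_conjugate h), convex_set (epi_conjugate h) &
      epi_conjugate h !=set0].
Proof.
move=> cvh ch; split; [exact: epi_conjugate_closed|exact: epi_conjugate_convex|].
exact: epi_conjugate_neq0.
Qed.

Lemma admissible_convex T H t x : admissible T H -> t \in `[0, T] ->
  convex_function setT (H t x) /\ continuous (H t x).
Proof.
move=> [_ cH cvH _] tT; split; first exact: cvH.
move=> p; have xp : (x, q) @[q --> p] --> (x, p).
  exact: (@cvg_pair _ _ _ (nbhs p) (nbhs x) (nbhs p) _ _ _ (cst x) id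
    (cvg_cst x) cvg_id).
exact: (cvg_comp _ _ xp (cH _ tT (x, p))).
Qed.

Section sequence.
Variables (T : R) (H_ : nat -> R -> 'rV[R]_n -> 'rV[R]_n -> R).
Variable H : R -> 'rV[R]_n -> 'rV[R]_n -> R.
Hypothesis cH : {within tdomain T, continuous (uncurry3 H)}.
Hypothesis aH_ : forall i, admissible T (H_ i).
Hypothesis aH : admissible T H.
Hypothesis H_H : compact_cvg T H_ H.

Section point.
Variables (K : set (R * 'rV[R]_n * 'rV[R]_(n + 1))).
Hypotheses (cK : compact K) (KT : K `<=` tdomain T).
Variables (i_ : nat -> nat) (z_ : nat -> R * 'rV[R]_n * 'rV[R]_(n + 1)).
Variable z : R * 'rV[R]_n * 'rV[R]_(n + 1).
Hypotheses (i_ge : forall k, (k <= i_ k)%N) (Kz_ : forall k, K (z_ k)) (Kz : K z).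
Hypothesis z_z : z_ k @[k --> \oo] --> z.

Let t_z : (z_ k).1.1 @[k --> \oo] --> z.1.1.
Proof. by apply: (cvg_comp _ _ (cvg_comp _ _ z_z cvg_fst) cvg_fst). Qed.

Let x_z : (z_ k).1.2 @[k --> \oo] --> z.1.2.
Proof. by apply: (cvg_comp _ _ (cvg_comp _ _ z_z cvg_fst) cvg_snd). Qed.

Let a_z : (z_ k).2 @[k --> \oo] --> z.2.
Proof. exact: (cvg_comp _ _ z_z cvg_snd). Qed.

(** [H] is jointly continuous, and [p] ranges over a compact ball. *)
Lemma hamiltonian_cvg_arg r d : 0 < d -> \forall k \near \oo,
  forall p, enorm p <= r ->
    `|H (z_ k).1.1 (z_ k).1.2 p - H z.1.1 z.1.2 p| <= d.
Proof.
move=> d0; have d2 : 0 < d / 2 by rewrite divr_gt0.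
have : \forall k \near \oo, eball 0 r `<=` (fun p : 'rV[R]_n =>
    `|H (z_ k).1.1 (z_ k).1.2 p - H z.1.1 z.1.2 p| <= d).
  apply: (iffLR (compact_near_coveringP _) (@eball_compact _ _ 0 r)
    _ _ (fun k p => `|H (z_ k).1.1 (z_ k).1.2 p - H z.1.1 z.1.2 p| <= d)).
  move=> p _.
  have zT : tdomain T (z.1.1, z.1.2, p) by exact: KT Kz.
  have /cvgrPdist_le/(_ _ d2) := (iffLR (subspace_continuousP _ _) cH) _ zT.
  rewrite near_withinE => -[[A B] /= [[[A1 A2] /= [zA1 zA2] A12] pB] AB].
  exists (B, [set k | A1 (z_ k).1.1 /\ A2 (z_ k).1.2]).
    by split => //=; apply: filterI; [exact: t_z|exact: x_z].
  move=> [q k] [/= Bq [A1k A2k]].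
  have h1 := AB ((z_ k).1.1, (z_ k).1.2, q) (conj (A12 (_, _) (conj A1k A2k)) Bq)
    (KT (Kz_ k)).
  have h2 := AB (z.1.1, z.1.2, q)
    (conj (A12 (_, _) (conj (nbhs_singleton zA1) (nbhs_singleton zA2))) Bq) (KT Kz).
  move: h1 h2; rewrite /from_subspace /uncurry3/= !ler_norml.
  by move=> /andP[? ?] /andP[? ?]; apply/andP; split; lra.
by apply: filterS => k kr p pr; apply: kr; rewrite /eball/= subr0.
Qed.

(** Uniform convergence is applied on the compact set of all [(t, x, p)] with
[(t, x)] below [K] and [p] in the ball of radius [r]. *)
Lemma hamiltonian_cvg r d : 0 < d -> \forall k \near \oo,
  forall p, enorm p <= r ->
    `|H_ (i_ k) (z_ k).1.1 (z_ k).1.2 p - H z.1.1 z.1.2 p| <= d.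
Proof.
move=> d0; have d2 : 0 < d / 2 by rewrite divr_gt0.
pose c (w : (R * 'rV[R]_n * 'rV[R]_(n + 1)) * 'rV[R]_n) := (w.1.1, w.2).
pose K' := c @` (K `*` eball 0 r).
have cK' : compact K'.
  apply: continuous_compact; last by apply: compact_setX => //; exact: eball_compact.
  apply: continuous_subspaceT => -[[w1 w2] p].
  exact: (@cvg_pair _ _ _ (nbhs (w1, w2, p)) (nbhs w1) (nbhs p) _ _ _
    (fun w => w.1.1) snd (cvg_comp _ _ cvg_fst cvg_fst) cvg_snd).
have K'T : K' `<=` tdomain T by move=> _ [[w p] [/= /KT wT _] <-].
have /uniform_cvg_normP/(_ _ d2)[N _ NK] := H_H cK' K'T.
have nN : \forall k \near \oo, (N <= k)%N by exact: nbhs_infty_ge.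
apply: filterS2 nN (hamiltonian_cvg_arg r d2) => k Nk kr p pr.
have : K' ((z_ k).1.1, (z_ k).1.2, p).
  exists (z_ k, p); last by rewrite /c/= -surjective_pairing.
  by split => //=; rewrite /eball/= subr0.
move=> /(NK (i_ k) (leq_trans Nk (i_ge k))); rewrite /uncurry3/=.
have := kr p pr; rewrite !ler_norml => /andP[? ?] /andP[? ?].
by apply/andP; split; lra.
Qed.

(** The continuous convergence of [rep_e (H_ i)] to [rep_e H]: index, time,
state and parameter vary together. *)
Lemma rep_e_cvg_seq :
  rep_e (H_ (i_ k)) (z_ k).1.1 (z_ k).1.2 (z_ k).2 @[k --> \oo] -->
  rep_e H z.1.1 z.1.2 z.2.
Proof.
rewrite rep_eE; under eq_cvg do rewrite rep_eE.
have body k := admissible_convex (z_ k).1.2 (aH_ (i_ k)) (KT (Kz_ k)).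
have [cvz cz] := admissible_convex z.1.2 aH (KT Kz).
apply: steiner_truncation_cvg; last exact: a_z.
- by move=> k; have [? ?] := body k; exact: epi_conjugate_body.
- exact: epi_conjugate_body.
- apply: kuratowski_epi_conjugate.
  + by move=> k; have [] := body k.
  + by move=> k; have [] := body k.
  + exact: hamiltonian_cvg.
Qed.

End point.
End sequence.

(** By compactness it suffices to treat [z] near a fixed point, where a failure
would yield sequences [i_ k] and [z_ k] as in the preceding lemma. Along them
both [rep_e (H_ (i_ k))] and [rep_e H] converge to the value of [rep_e H] at the
limit point, which contradicts the gap [e]. Sequences are used because
dominated convergence holds for them only. *)
Lemma rep_e_compact_cvg T (H_ : nat -> R -> 'rV[R]_n -> 'rV[R]_n -> R) H
    (K : set (R * 'rV[R]_n * 'rV[R]_(n + 1))) e :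
  {within tdomain T, continuous (uncurry3 H)} ->
  (forall i, admissible T (H_ i)) -> admissible T H ->
  compact_cvg T H_ H -> compact K -> K `<=` tdomain T -> 0 < e ->
  \forall i \near \oo, forall z, K z ->
    enorm (rep_e (H_ i) z.1.1 z.1.2 z.2 - rep_e H z.1.1 z.1.2 z.2) <= e.
Proof.
move=> cH aH_ aH H_H cK KT e0.
pose bad i z :=
  e < enorm (rep_e (H_ i) z.1.1 z.1.2 z.2 - rep_e H z.1.1 z.1.2 z.2).
suff : \forall i \near \oo, K `<=` (fun z => K z -> ~ bad i z).
  by apply: filterS => i iK z Kz; rewrite leNgt; apply/negP; exact: iK.
apply: (iffLR (compact_near_coveringP K) cK _ _ (fun i z => K z -> ~ bad i z)).
move=> z Kz; apply: contrapT => nz.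
have seq k : exists iw, [/\ (k <= iw.1)%N, K iw.2, ball z k.+1%:R^-1 iw.2 &
    bad iw.1 iw.2].
  apply: contrapT => nk; apply: nz.
  exists (ball z k.+1%:R^-1, [set i | (k <= i)%N]).
    by split; [apply: nbhsx_ballx|exact: nbhs_infty_ge].
  move=> [w i] [/= zw ki] Kw bw; apply: nk; by exists (i, w).
have [s sP] := choice seq.
have z_z : (s k).2 @[k --> \oo] --> z.
  apply/cvg_ballP => d d0; have [N _ Nd] := near_infty_natSinv_lt (PosNum d0).
  exists N => // k /Nd kd; have [_ _ + _] := sP k.
  by apply: le_ball; exact: ltW.
have i_ge k : (k <= (s k).1)%N by case: (sP k).
have Kz_ k : K (s k).2 by case: (sP k).
have c1 := rep_e_cvg_seq cH aH_ aH H_H cK KT i_ge Kz_ Kz z_z.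
have HH : compact_cvg T (fun=> H) H.
  move=> C _ _; apply/uniform_cvg_normP => d d0; apply: nearW => i y _.
  by rewrite subrr normr0 ltW.
have c2 := rep_e_cvg_seq cH (fun=> aH) aH HH cK KT i_ge Kz_ Kz z_z.
have l0 : enorm (rep_e H z.1.1 z.1.2 z.2 - rep_e H z.1.1 z.1.2 z.2) < e.
  by rewrite (subrr (rep_e H z.1.1 z.1.2 z.2)) enorm0.
have [N _ /(_ N (leqnn N)) lt] := cvgr_lt _ (enormB_cvg c1 c2) _ l0.
have [_ _ _ bN] := sP N.
by have := lt_trans bN lt; rewrite ltxx.
Qed.
Lemma rsubmx_le_enorm (e f : 'rV[R]_(n + 1)) :
  `|rsubmx e ord0 ord0 - rsubmx f ord0 ord0| <= enorm (e - f).
Proof. by apply: le_trans (coord_le_enorm _ (rshift n ord0)); rewrite !mxE. Qed.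

Lemma enorm_lsubmx_le (e : 'rV[R]_(n + 1)) : enorm (lsubmx e) <= enorm e.
Proof.
rewrite ler_sqrt ?dotv_ge0// [leRHS]/dotv big_split_ord/= -[leLHS]addr0 lerD//.
  by rewrite le_eqVlt; apply/orP; left; apply/eqP/eq_bigr => i _; rewrite !mxE.
by apply: sumr_ge0 => i _; rewrite -expr2 sqr_ge0.
Qed.

(** If the component [v] of [e] were longer than the Lipschitz constant [c], then [<v, p> - h p] would
be unbounded along the ray of [v]; the multiple [s v] chosen here exceeds the
bound given by [e]. *)
Lemma epi_conjugate_lipschitz h c e : 0 <= c ->
  (forall p q, `|h p - h q| <= c * enorm (p - q)) -> epi_conjugate h e ->
  enorm (lsubmx e) <= c.
Proof.
move=> c0 hc eE; rewrite leNgt; apply/negP => ec.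
set v := lsubmx e in ec; set b := rsubmx e ord0 ord0.
have v0 : 0 < enorm v by exact: le_lt_trans ec.
have vc : 0 < enorm v * (enorm v - c) by rewrite mulr_gt0// subr_gt0.
have hb : 0 <= h 0 + b.
  by have := eE 0; rewrite dotv_row_mxE dotv0l -/b; lra.
pose s := (h 0 + b + 1) / (enorm v * (enorm v - c)).
have s0 : 0 <= s by rewrite divr_ge0// ?ltW//; lra.
have sE : s * (enorm v * (enorm v - c)) = h 0 + b + 1.
  by rewrite /s divfK// gt_eqF.
have := eE (s *: v); rewrite dotv_row_mxE -/v -/b dotvZl -enorm_sqr.
have := hc (s *: v) 0; rewrite subr0 enormZ (ger0_norm s0) ler_norml.
by move=> /andP[_ h1] h2; nra.
Qed.

(** The velocity components of the points of the truncated epigraph lie in a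
ball, and so does their average. *)
Lemma enorm_rep_f_le T H t x a c : admissible T H -> t \in `[0, T] ->
  0 <= c -> (forall p q, `|H t x p - H t x q| <= c * enorm (p - q)) ->
  enorm (rep_f H t x a) <= c.
Proof.
move=> aH tT c0 Hc.
have [cvh ch] := admissible_convex x aH tT.
have [cE cvE E0] := epi_conjugate_body cvh ch.
have [cK cvK K0] := truncation_body a cE cvE E0.
rewrite /rep_f rep_eE; set K := truncation _ _ in cK cvK K0 *.
set v := lsubmx _; have [->|v0] := eqVneq (enorm v) 0; first exact: c0.
have {}v0 : 0 < enorm v by rewrite lt_neqAle eq_sym v0 enorm_ge0.
rewrite -(ler_pM2l v0) -expr2 enorm_sqr.
have vE w : dotv v (lsubmx w) = dotv (row_mx v 0%:M) w.
  by rewrite dotv_row_mxE mul0r addr0.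
rewrite vE; apply: dotv_steiner_le => //; first by rewrite mulr_ge0// ltW.
move=> w [Ew _]; rewrite -vE (le_trans (dotv_le _ _))// ler_wpM2l ?(ltW v0)//.
exact: epi_conjugate_lipschitz Ew.
Qed.

End convergence_of_representations.

Unset Implicit Arguments.
Set Strict Implicit.

Theorem theorem3p9 (R : realType) (n : nat) (T : R) (T0 : 0 < T)
    (H_ : nat -> R -> 'rV[R]_n -> 'rV[R]_n -> R)
    (H : R -> 'rV[R]_n -> 'rV[R]_n -> R)
    (cH_ : forall i, {within tdomain T, continuous (uncurry3 (H_ i))})
    (cH : {within tdomain T, continuous (uncurry3 H)})
    (aH_ : forall i, admissible T (H_ i))
    (aH : admissible T H) :
  (compact_cvg T H_ H ->
     compact_cvg T (fun i => rep_f (H_ i)) (rep_f H) /\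
     compact_cvg T (fun i => rep_l (H_ i)) (rep_l H)) /\
  (forall (c_ : nat -> R -> R) (c : R -> R),
     (forall i, lebesgue_measurable_fun `[0, T] (c_ i)) ->
     lebesgue_measurable_fun `[0, T] c ->
     (forall i t, t \in `[0, T] -> 0 <= c_ i t) ->
     (forall t, t \in `[0, T] -> 0 <= c t) ->
     (forall i t x p q, t \in `[0, T] ->
        `|H_ i t x p - H_ i t x q| <= c_ i t * (1 + enorm x) * enorm (p - q)) ->
     (forall t x p q, t \in `[0, T] ->
        `|H t x p - H t x q| <= c t * (1 + enorm x) * enorm (p - q)) ->
     (forall i t x a, t \in `[0, T] ->
        enorm (rep_f (H_ i) t x a) <= c_ i t * (1 + enorm x)) /\
     (forall t x a, t \in `[0, T] ->
        enorm (rep_f H t x a) <= c t * (1 + enorm x))).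
Proof.
split=> [H_H|c_ c _ _ c_0 c0 Hc_ Hc].
  split=> K cK KT; apply/uniform_cvg_normP => e e0;
    apply: filterS (rep_e_compact_cvg cH aH_ aH H_H cK KT e0) => i iK z Kz;
    apply: le_trans (iK z Kz).
    rewrite (le_trans (norm_le_enorm _))// (le_trans _ (enorm_lsubmx_le _))//.
    by rewrite raddfB.
  exact: rsubmx_le_enorm.
have n0 (x : 'rV[R]_n) : 0 <= 1 + enorm x by rewrite addr_ge0// enorm_ge0.
split=> [i|] t x a tT.
  apply: (enorm_rep_f_le _ (aH_ i) tT); first by rewrite mulr_ge0 ?c_0.
  by move=> p q; exact: Hc_.
apply: (enorm_rep_f_le _ aH tT); first by rewrite mulr_ge0 ?c0.
by move=> p q; exact: Hc.
Qed.
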